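(* Let $D \subset \mathbb{C}^{n}$ be a bounded domain with smooth boundary that satisfies the following conditions: (1) each $f \in \mathrm{Aut}(D)$ extends as a diffeomorphism to $\overline{D}$; (2) if $(f_k)$ is a sequence in $\mathrm{Aut}(D)$ and $f_k \to f$ in $\mathrm{Aut}(D)$, then $f_k \to f$ in the $\mathcal{C}^{\infty}$-topology on $\overline{D}$ (i.e. each component of $f_k$ converges to the corresponding component of $f$ in the $\mathcal{C}^{\infty}$-topology on $\overline{D}$). Then for each compact subgroup $H \subset \mathrm{Aut}(D)$ there is a number $m\in \mathbb{N}$ (depending only on $D$ and $H$) such that if $f \in H$ has a discrete fixed point set $\mathrm{Fix}(f)$, then $\mathrm{Fix}(f)$ is a finite set of cardinality at most $m$.
   Context: A domain is a nonempty connected open set; ''smooth'' means $C^\infty$. $\mathrm{Aut}(D)$ is the group of biholomorphic maps $D\to D$, endowed with the compact-open topology (uniform convergence on compact subsets of $D$); convergence in $\mathrm{Aut}(D)$ and compactness of subgroups refer to this topology. The fixed point set is $\mathrm{Fix}(f)=\{z\in D: f(z)=z\}$; it is discrete if each of its points is isolated in it (the empty set is discrete). ''Extends as a diffeomorphism to $\overline D$'' means that $f$ extends to a $C^\infty$ diffeomorphism of $\overline{D}$ onto $\overline{D}$. Convergence in the $\mathcal{C}^\infty$-topology on $\overline D$ means uniform convergence on $\overline{D}$ of the (extended) functions together with all their partial derivatives of every order. *)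

(* Defs.v *)
From HB Require Import structures.
From mathcomp Require Import all_boot all_order all_algebra.
From mathcomp Require Import complex.
From mathcomp Require Import all_classical all_reals all_analysis.
Set Implicit Arguments.
Unset Strict Implicit.
Unset Printing Implicit Defensive.
Import Order.TTheory GRing.Theory Num.Theory.
Import numFieldNormedType.Exports.
Local Open Scope classical_set_scope.
Local Open Scope ring_scope.
Local Open Scope complex_scope.

(* R[i] has no topology in the libraries: give it the one of the modulus, as
   numFieldNormedType does for abstract number fields. *)
Section ComplexTopology.
Context (R : realType).
#[non_forgetful_inheritance]
HB.instance Definition _ := GRing.ComAlgebra.copy R[i] R[i]^o.
#[non_forgetful_inheritance]
HB.instance Definition _ := Vector.copy R[i] R[i]^o.
#[non_forgetful_inheritance]
HB.instance Definition _ := NormedModule.copy R[i] R[i]^o.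
End ComplexTopology.

Section ComplexSpace.
Context {R : realType} {n : nat}.
Local Notation Cn := 'rV[R[i]]_n.
Implicit Types (D U A : set Cn) (g : Cn -> R) (F G : Cn -> Cn).

(* C^n is R^(2n) with real coordinates x_j = Re z_j, indexed by (j, false),
   and y_j = Im z_j, indexed by (j, true). *)
Definition rcoord : Type := ('I_n * bool)%type.

Definition real_coord (c : rcoord) (z : Cn) : R :=
  if c.2 then complex.Im (z 0 c.1) else complex.Re (z 0 c.1).

Definition rdir (c : rcoord) : Cn :=
  (if c.2 then 'i else 1 : R[i]) *: delta_mx 0 c.1.

Definition slice (c : rcoord) g (z : Cn) (t : R) : R := g (z + t%:C *: rdir c).

Definition pderivable (c : rcoord) g (z : Cn) := derivable (slice c g z) 0 1.

Definition pderiv (c : rcoord) g (z : Cn) : R := derive1 (slice c g z) 0.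

Definition pderivs (s : seq rcoord) g : Cn -> R := foldr pderiv g s.

Definition smooth U g := forall (s : seq rcoord) (z : Cn), U z ->
  {for z, continuous (pderivs s g)} /\
  forall c, pderivable c (pderivs s g) z.

Definition smooth_map U F := forall c, smooth U (real_coord c \o F).

(* Smoothness on an arbitrary set: local smooth extendability. *)
Definition smooth_map_on A F := forall z, A z ->
  exists U G, [/\ open_nbhs z U, smooth_map U G & {in U `&` A, F =1 G}].

Definition closure_diffeo D F := exists G,
  [/\ set_fun (closure D) (closure D) F, set_fun (closure D) (closure D) G,
      {in closure D, cancel F G}, {in closure D, cancel G F} &
      smooth_map_on (closure D) F /\ smooth_map_on (closure D) G].

Definition domain D := [/\ D !=set0, open D & connected D].

(* Near each boundary point, D is {r < 0} for a smooth r with dr <> 0. *)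
Definition smooth_boundary D := forall p, (closure D `\` D) p ->
  exists (U : set Cn) (r : Cn -> R),
    [/\ open_nbhs p U, smooth U r,
        forall z, U z -> exists c, pderiv c r z != 0 &
        forall z, U z -> (D z <-> r z < 0)].

(* Self-maps of D are functions on the subtype D; ext0 prolongs them by 0.
   As D is open, derivatives at points of D do not depend on this choice. *)
Definition ext0 D (f : D -> D) : Cn -> Cn := 'valL_(0 : Cn) (set_val \o f).

(* 'differentiable' is with respect to the complex scalars. *)
Definition holomorphic D (f : D -> D) :=
  forall z, D z -> differentiable (ext0 f) z.

Definition holoAut D : set (D -> D) := [set f | holomorphic f /\
  exists f', [/\ cancel f f', cancel f' f & holomorphic f']].

Arguments holoAut D _ : clear implicits.

Definition subgroup_holoAut D (H : set (D -> D)) :=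
  [/\ H `<=` holoAut D, H id, forall f f', H f -> H f' -> H (f \o f') &
      forall f, H f -> exists2 f', H f' & cancel f f' /\ cancel f' f].

(* Values on the closure of D of the continuous extension of h from D. *)
Definition closure_ext D (h : Cn -> R) (z : Cn) : R :=
  lim (h w @[w --> within D (nbhs z)]).

Definition smooth_cvg D (f_ : nat -> D -> D) (f : D -> D) :=
  forall (c : rcoord) (s : seq rcoord),
    {uniform closure D,
      (fun k => closure_ext D (pderivs s (real_coord c \o ext0 (f_ k))))
        @ \oo -->
      closure_ext D (pderivs s (real_coord c \o ext0 f))}.

Definition Fix D (f : D -> D) : set D := [set z | f z = z].

End ComplexSpace.

Arguments holoAut {R n} D _.

(* Main.v *)
Require Import Defs.
From HB Require Import structures.
From mathcomp Require Import all_boot all_order all_algebra.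
From mathcomp Require Import complex ring lra.
From mathcomp Require Import all_classical all_reals all_analysis.
Import Order.TTheory GRing.Theory Num.Theory.
Import numFieldNormedType.Exports.
Local Open Scope classical_set_scope.
Local Open Scope ring_scope.
Local Open Scope complex_scope.

(** The theorem holds because two fixed points of an element of H that are
closer than a threshold depending only on D and H force fixed points to
accumulate at each of them.  Discrete fixed point sets are thus uniformly
separated, and a bounded set holds boundedly many points of a separated family
([separated_card]).

The threshold comes from linearization.  Let f in H fix a, and let A be its
real differential there.  Since H is a group, all the powers of f lie in it, and
the averages
    Phi_N (x) = 1/N * sum_(j < N) A^(-j) (f^j (x) - a)
conjugate f to A up to an error of order 1/N, with differential the identity
at a.  If the elements of H have first order expansions with uniformly
bounded coefficients and quadratic remainders, every Phi_N is close to the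
identity on the part of D within a distance r of a, with r independent of f,
a and N.  Let b be another fixed point within r of a.  The vector Phi_N (b) is
almost fixed by A, so solving Phi_N (z) = t Phi_N (b) for a small t > 0 gives
points z that are almost fixed by f, close to a, and no closer to it than a
multiple of t |b - a|.  A limit of these points as N grows is a fixed point of
f other than a ([other_fixed_points_nearby]).  The argument near a takes place in a
ball contained in D, while the ball of radius |b - a| around a may well leave D:
the bounds have to hold uniformly up to the boundary.

The uniform expansions ([map_expansion]) follow from two facts.  The first is a
bound, uniform over H and D, on the partial derivatives of order one and two
([uniform_pderivs_bound]): each element of H has bounded derivatives since it
extends smoothly to the compact closure of D, and a sequence of elements of H
with derivatives going to infinity would have a subsequence converging in H,
hence with all derivatives by assumption.  The second is the quasi-convexity of
D ([quasi_convex]): nearby points are joined inside D by a path of comparable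
length, so that bounds on derivatives integrate up to the boundary.

All estimates are real: complex n-space is identified with a space of row
vectors under the supremum norm of the 2n real coordinates ([realify]). *)

Set Implicit Arguments.
Unset Strict Implicit.

(** * Row vectors *)

Section RowVectors.
Context {R : realType} {m : nat}.
Local Notation E := 'rV[R]_m.

Lemma norm_entry (p q : nat) (M : 'M[R]_(p, q)) i j : `|M i j| <= `|M|.
Proof.
rewrite [leRHS]/Num.norm /= mx_normrE.
exact: (le_bigmax _ (fun ij : 'I_p * 'I_q => `|M ij.1 ij.2|) (i, j)).
Qed.

Lemma norm_row_le (v : E) (c : R) :
  0 <= c -> (forall i, `|v 0 i| <= c) -> `|v| <= c.
Proof.
move=> c0 vc; rewrite [leLHS]/Num.norm /= mx_normrE.
by apply/bigmax_leP; split => // -[i j] _ /=; rewrite ord1.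
Qed.

Lemma norm_row_lt (v : E) (c : R) :
  0 < c -> (forall i, `|v 0 i| < c) -> `|v| < c.
Proof.
move=> c0 vc; rewrite [ltLHS]/Num.norm /= mx_normrE.
by apply/bigmax_ltP; split => // -[i j] _ /=; rewrite ord1.
Qed.

Lemma norm_mulmx (v : E) (A : 'M[R]_m) (c : R) :
  0 <= c -> (forall i j, `|A i j| <= c) -> `|v *m A| <= m%:R * c * `|v|.
Proof.
move=> c0 Ac.
apply: norm_row_le => [|j]; first by rewrite !mulr_ge0.
rewrite mxE (le_trans (ler_norm_sum _ _ _))//.
have -> : m%:R * c * `|v| = \sum_(i < m) `|v| * c.
  by rewrite sumr_const card_ord -mulr_natl; ring.
by apply: ler_sum => i _; rewrite normrM ler_pM ?norm_entry.
Qed.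

Lemma row_subE (u v : E) k : (u - v) 0 k = u 0 k - v 0 k.
Proof. by rewrite !mxE. Qed.

End RowVectors.

(** * Linearization at a fixed point *)

(** Contractions of row vectors then have fixed points. *)
HB.instance Definition _ (R : realType) m := Complete.on 'rV[R]_m.

(** The equation P z = w is a fixed point equation for z |-> w + (z - P z), a
contraction of the ball.  What matters below is that the radius does not
depend on P. *)
Lemma near_identity_solve (R : realType) (V : completeNormedModType R)
    (P : V -> V) (a w : V) (r : R) :
  (forall x y, `|x - a| <= r -> `|y - a| <= r ->
     `|P x - P y - (x - y)| <= 2^-1 * `|x - y|) ->
  P a = 0 -> `|w| <= 2^-1 * r -> exists2 z, `|z - a| <= r & P z = w.
Proof.
move=> Pid Pa wr.
have r0 : 0 <= r by have := normr_ge0 w; lra.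
pose U := closed_ball_ (fun x : V => `|x|) a r.
pose T z := w + (z - P z).
have UP z : U z <-> `|z - a| <= r by rewrite /U /closed_ball_/= distrC.
have aU : U a by apply/UP; rewrite subrr normr0.
have TU : set_fun U U T.
  move=> z /UP za; apply/UP.
  have := Pid z a za; rewrite subrr normr0 Pa subr0 => /(_ r0) H.
  have -> : T z - a = w - (P z - (z - a)).
    by rewrite /T opprB -addrA [z - P z - a]addrAC.
  by apply: le_trans (ler_normB _ _) _; lra.
have Tc : is_contraction (mkfun_fun TU).
  exists (2^-1%:nng); split => /=; first by lra.
  move=> [x y] [/= /UP xa /UP ya]; rewrite /mkfun.
  have -> : T x - T y = - (P x - P y - (x - y)).
    by rewrite /T opprD addrACA subrr add0r !opprB addrACA [RHS]addrACA [- y - _]addrC.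
  by rewrite normrN; exact: Pid.
have [|z Uz zT] := banach_fixed_point Tc _ (ex_intro _ a aU).
  exact: closed_closed_ball_.
exists z; first exact/UP.
have : z = T z by [].
move/eqP; rewrite /T addrCA -subr_eq0 opprD addrA subrr add0r oppr_eq0 subr_eq0.
by move/eqP.
Qed.

(** The matrices act on row vectors from the right.  [A] stands for the
differential of [f] at [a] and [B j] for that of its j-th inverse power.  The
ball of radius [r] around [a], which contains [b], need not lie in [X]. *)
Section Dynamics.
Context {R : realType} {m : nat}.
Local Notation E := 'rV[R]_m.

Variables (X : set E) (f : E -> E) (A : 'M[R]_m) (B : nat -> 'M[R]_m).
Variables (a b : E) (r : R).
Hypothesis B0 : B 0%N = 1%:M.
Hypothesis BA : forall j, B j.+1 *m A = B j.
Hypothesis fX : forall x, X x -> X (f x).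
Hypothesis fa : f a = a.
Hypothesis Xa : X a.
Hypothesis nearX : nbhs a X.
Hypothesis near_id : forall j x y, X x -> X y -> `|x - a| <= r ->
  `|y - a| <= r ->
  `|(iter j f x - iter j f y) *m B j - (x - y)| <= 2^-1 * `|x - y|.

(** The linearizing averages, and the defect of their equivariance: Phi o f is
(Phi + err) A. *)
Let Phi N x : E := N.+1%:R^-1 *: \sum_(j < N.+1) (iter j f x - a) *m B j.
Let err N x : E :=
  N.+1%:R^-1 *: ((iter N.+1 f x - a) *m B N.+1 - (x - a)).

Let iter_a j : iter j f a = a.
Proof. by elim: j => //= j ->. Qed.

Let Phi_a N : Phi N a = 0.
Proof.
by rewrite /Phi big1 ?scaler0// => j _; rewrite iter_a subrr mul0mx.
Qed.

Let Phi_near_id N x y : X x -> X y -> `|x - a| <= r -> `|y - a| <= r ->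
  `|Phi N x - Phi N y - (x - y)| <= 2^-1 * `|x - y|.
Proof.
move=> Xx Xy xa ya; rewrite /Phi.
rewrite -scalerBr -sumrB.
have -> : x - y = N.+1%:R^-1 *: \sum_(j < N.+1) (x - y).
  by rewrite sumr_const card_ord -[(x - y) *+ _]scaler_nat scalerA mulVf ?scale1r.
rewrite -scalerBr -sumrB !normrZ !ger0_norm// mulrCA ler_pM2l//.
apply: le_trans (ler_norm_sum _ _ _) _.
rewrite sumr_const card_ord -[(x - y) *+ _]scaler_nat normrZ ger0_norm//.
have -> : 2^-1 * (N.+1%:R * `|x - y|) = \sum_(j < N.+1) (2^-1 * `|x - y|).
  by rewrite sumr_const card_ord -[RHS]mulr_natl mulrCA.
by apply: ler_sum => j _; rewrite -mulmxBl opprB addrA subrK; exact: near_id.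
Qed.

Let Phi_f N x : Phi N (f x) = (Phi N x + err N x) *m A.
Proof.
rewrite /Phi /err -scalerDr -scalemxAl; congr (_ *: _).
have -> : \sum_(j < N.+1) (iter j f (f x) - a) *m B j =
    (\sum_(j < N.+1) (iter j.+1 f x - a) *m B j.+1) *m A.
  rewrite mulmx_suml; apply: eq_bigr => j _.
  by rewrite -mulmxA BA -iterSr.
congr (_ *m A).
rewrite big_ord_recr [X in _ = X + _]big_ord_recl /= B0 mulmx1.
by rewrite [X in _ = X + _]addrC [RHS]addrA [RHS]addrAC addrK.
Qed.

Hypothesis fb : f b = b.
Hypothesis Xb : X b.
Hypothesis ba : b != a.
Hypothesis br : `|b - a| <= r.

(** Since [b] is fixed, Phi N b is mapped to itself by [A] up to O(1/N), and so
is every point z with Phi N z = t Phi N b; as Phi N is bi-Lipschitz, f z is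
within O(1/N) of z.  The same property keeps z close to [a] for small t, and
away from [a] uniformly in N, so that a cluster point of such z is a fixed
point of the required kind.  No eigenvector of [A] has to be produced. *)
Lemma other_fixed_points_nearby (e : R) : 0 < e ->
  exists z, [/\ X z, z != a, `|z - a| < e & f z = z].
Proof.
move=> e0.
pose K := m%:R * `|A|.
have K0 : 0 <= K by rewrite mulr_ge0.
have AK (v : E) : `|v *m A| <= K * `|v|.
  by rewrite /K; apply: norm_mulmx => // i j; exact: norm_entry.
have ba0 : 0 < `|b - a| by rewrite normr_gt0 subr_eq0.
have r0 : 0 < r by exact: lt_le_trans br.
(* B 1 is inverse to A: near_id for j = 1 controls f itself. *)
have fLip x y : X x -> X y -> `|x - a| <= r -> `|y - a| <= r ->
    `|f x - f y| <= K * (3 / 2 * `|x - y|).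
  move=> Xx Xy xa ya; have /= H := near_id 1 Xx Xy xa ya.
  have -> : f x - f y = (f x - f y) *m B 1 *m A by rewrite -mulmxA BA B0 mulmx1.
  apply: le_trans (AK _) _; apply: ler_wpM2l => //.
  have := ler_normD ((f x - f y) *m B 1 - (x - y)) (x - y).
  by rewrite subrK; lra.
have errK N x : X x -> `|x - a| <= r -> `|err N x| <= N.+1%:R^-1 * r.
  move=> Xx xa; rewrite /err normrZ ger0_norm// ler_pM2l//.
  have := near_id N.+1 Xx Xa xa.
  rewrite subrr normr0 => /(_ (ltW r0)); rewrite iter_a; lra.
have [d /= d0 dX] : exists2 d : R, 0 < d & forall x, `|x - a| < d -> X x.
  have /nbhs_ballP[d /= d0 dX] := nearX.
  by exists d => // x xd; apply: dX; rewrite -ball_normE/= distrC.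
(* The ball of radius rho lies in X and f maps it into the ball of radius r;
   t is chosen so that t Phi N b has norm at most rho / 2. *)
pose rho := Num.min (Num.min r (r / (K * (3 / 2) + 1))) (Num.min (d / 2) (e / 2)).
have K1 : 0 < K * (3 / 2) + 1 by lra.
have rho0 : 0 < rho by rewrite !lt_min r0 !divr_gt0.
have [rho_r rho_K rho_d rho_e] :
  [/\ rho <= r, rho <= r / (K * (3 / 2) + 1), rho <= d / 2 & rho <= e / 2].
  by have := lexx rho; rewrite {2}/rho !le_min => /andP[/andP[-> ->] /andP[-> ->]].
pose t := rho / (3 * `|b - a|).
have t0 : 0 < t by rewrite divr_gt0// mulr_gt0.
have Xrho x : `|x - a| <= rho -> X x by move=> xa; apply: dX; lra.
have frho x : `|x - a| <= rho -> `|f x - a| <= r.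
  move=> xa; have := fLip x a (Xrho _ xa) Xa (le_trans xa rho_r).
  rewrite subrr normr0 fa => /(_ (ltW r0)) H; apply: le_trans H _.
  rewrite mulrA; move: rho_K; rewrite ler_pdivlMr// => rho_K.
  have : K * (3 / 2) * `|x - a| <= K * (3 / 2) * rho by apply: ler_wpM2l; lra.
  lra.
have Phi_size N x : X x -> `|x - a| <= r ->
    2^-1 * `|x - a| <= `|Phi N x| <= 3 / 2 * `|x - a|.
  move=> Xx xa; have := Phi_near_id N Xx Xa xa.
  rewrite subrr normr0 Phi_a subr0 => /(_ (ltW r0)) H.
  have := ler_normD (Phi N x - (x - a)) (x - a); rewrite subrK => H1.
  have := ler_normB (Phi N x) (Phi N x - (x - a)); rewrite subKr => H2.
  by apply/andP; split; lra.
have zP N : exists z, `|z - a| <= rho /\ Phi N z = t *: Phi N b.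
  have [x y xa ya|||z za Pz] :=
    near_identity_solve (P := Phi N) (a := a) (w := t *: Phi N b) (r := rho).
  - by apply: Phi_near_id; [exact: Xrho|exact: Xrho|exact: le_trans rho_r..].
  - exact: Phi_a.
  - rewrite normrZ gtr0_norm//; have /andP[_ H] := Phi_size N _ Xb br.
    apply: le_trans (ler_wpM2l (ltW t0) H) _.
    suff -> : t * (3 / 2 * `|b - a|) = 2^-1 * rho by [].
    by rewrite /t; field; rewrite gt_eqF.
  by exists z.
have [z zrho] := choice zP.
pose c := t * `|b - a| / 3.
have c0 : 0 < c by apply: divr_gt0 => //; exact: mulr_gt0.
have zc N : c <= `|z N - a|.
  have [za Pz] := zrho N.
  have /andP[_] := Phi_size N _ (Xrho _ za) (le_trans za rho_r).
  have /andP[H _] := Phi_size N _ Xb br.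
  rewrite Pz normrZ gtr0_norm//.
  have := ler_wpM2l (ltW t0) H; rewrite /c; lra.
have fz N : `|f (z N) - z N| <= N.+1%:R^-1 * (2 * (t + 1) * (K * r)).
  have [za Pz] := zrho N.
  have zr := le_trans za rho_r.
  have Xz := Xrho _ za.
  have := Phi_near_id N (fX Xz) Xz (frho _ za) zr.
  have -> : Phi N (f (z N)) - Phi N (z N) = (err N (z N) - t *: err N b) *m A.
    have Pb : Phi N b *m A = Phi N b - err N b *m A.
      by rewrite -{2}fb Phi_f mulmxDl addrK.
    rewrite Phi_f Pz mulmxDl -scalemxAl Pb scalerBr mulmxBl -[(t *: err N b) *m A]scalemxAl.
    by rewrite addrC !addrA addNr add0r addrC.
  have H : `|(err N (z N) - t *: err N b) *m A| <=
      N.+1%:R^-1 * ((t + 1) * (K * r)).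
    apply: le_trans (AK _) _.
    have -> : N.+1%:R^-1 * ((t + 1) * (K * r)) =
      K * (N.+1%:R^-1 * r + t * (N.+1%:R^-1 * r)) by ring.
    apply: ler_wpM2l => //; apply: le_trans (ler_normB _ _) _.
    by rewrite lerD ?errK// normrZ gtr0_norm// ler_pM2l// errK.
  have := ler_normB ((err N (z N) - t *: err N b) *m A)
    ((err N (z N) - t *: err N b) *m A - (f (z N) - z N)).
  rewrite subKr => H1 H2.
  have -> : N.+1%:R^-1 * (2 * (t + 1) * (K * r)) =
    2 * (N.+1%:R^-1 * ((t + 1) * (K * r))) by ring.
  move: H H1 H2; set q := N.+1%:R^-1 * _; lra.
pose S := [set x : E | `|x - a| <= rho].
have cS : compact S.
  apply: bounded_closed_compact.
    exists (`|a| + rho); split; first exact: num_real.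
    move=> M aM x /= xa.
    have := ler_normD (x - a) a; rewrite subrK.
    by move: xa aM; rewrite /S/=; lra.
  rewrite (_ : S = closed_ball_ (fun x : E => `|x|) a rho).
    exact: closed_closed_ball_.
  by apply/seteqP; split => x; rewrite /S/closed_ball_/= distrC.
have [p [Sp clp]] : S `&` cluster (z @ \oo) !=set0.
  apply: cS; suff : \forall N \near \oo, S (z N) by [].
  by apply: nearW => N; have [] := zrho N.
have closeP (k : R) : 0 < k -> exists N, `|p - z N| < k /\
    N.+1%:R^-1 * (2 * (t + 1) * (K * r)) < k.
  move=> k0.
  pose s : R := 2 * (t + 1) * (K * r).
  have /(clp _ (ball p k)) : (z @ \oo) (z @` [set N : nat | N.+1%:R^-1 * s < k]).
    suff : \forall N \near \oo, N.+1%:R^-1 * s < k.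
      by apply: filterS => N sN; exists N.
    near=> N; rewrite ltr_pdivrMl// -ltr_pdivrMr//.
    have : s / k < N%:R by near: N; exact: nbhs_infty_gtr.
    by move=> /lt_trans; apply; rewrite ltr_nat.
  move=> /(_ (nbhsx_ballx _ _ k0))[_ [[N NN <-]]].
  by rewrite -ball_normE/= => pz; exists N.
exists p; split.
- exact: Xrho.
- rewrite -subr_eq0 -normr_gt0 ltNge; apply/negP => p0.
  have [N [pN _]] := closeP c c0.
  have := ler_distD p (z N) a; rewrite [`|z N - p|]distrC.
  have := zc N; lra.
- by apply: le_lt_trans Sp _; lra.
- apply/eqP; rewrite -subr_eq0 -normr_le0; apply/ler_addgt0Pr => k k0.
  rewrite add0r.
  have k'0 : 0 < k / (2 + K * (3 / 2)) by rewrite divr_gt0//; lra.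
  have [N [pN zN]] := closeP _ k'0.
  have [za Pz] := zrho N.
  have H1 := fLip _ _ (Xrho _ Sp) (Xrho _ za) (le_trans Sp rho_r) (le_trans za rho_r).
  have H2 := le_lt_trans (fz N) zN.
  have -> : f p - p = (f p - f (z N)) + (f (z N) - z N) - (p - z N).
    by rewrite addrA subrK opprB addrA subrK.
  apply: le_trans (ler_normB _ _) _.
  have H3 := ler_normD (f p - f (z N)) (f (z N) - z N).
  have H4 : K * (3 / 2 * `|p - z N|) <= K * (3 / 2) * (k / (2 + K * (3 / 2))).
    by rewrite mulrA ler_wpM2l ?(ltW pN)//; lra.
  have H5 : (2 + K * (3 / 2)) * (k / (2 + K * (3 / 2))) = k.
    by rewrite mulrC divfK// gt_eqF//; lra.
  lra.
Unshelve. all: by end_near.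
Qed.
End Dynamics.

(** * Groups of maps with uniform first-order expansions *)

Section Group.
Context {R : realType} {m : nat}.
Local Notation E := 'rV[R]_m.
Variables (X : set E) (C delta : R).
Hypothesis C1 : 1 <= C.
Hypothesis delta0 : 0 < delta.

Let C0 : 0 <= C. Proof. exact: le_trans C1. Qed.

(** [J] plays the role of the differential of [h] at [a], acting on row vectors
from the right; the estimate says that h - J is Lipschitz on the part of [X]
within r of [a], with a constant linear in r. *)
Definition expansion (h : E -> E) (a : E) (J : 'M[R]_m) :=
  (forall i j, `|J i j| <= C) /\
  forall r x y, X x -> X y -> r <= delta -> `|x - a| <= r -> `|y - a| <= r ->
    `|h x - h y - (x - y) *m J| <= C * r * `|x - y|.

(** The chain rule: first order coefficients at an interior point are unique,
and h2 o h1 = h3 has both [J3] and [J1 *m J2] as such.  The order of the product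
is that of right actions. *)
Lemma expansion_comp (a : E) (h1 h2 h3 : E -> E) (J1 J2 J3 : 'M[R]_m) :
  nbhs a X -> h1 a = a -> h2 a = a -> (forall x, X x -> X (h1 x)) ->
  (forall x, X x -> h2 (h1 x) = h3 x) ->
  expansion h1 a J1 -> expansion h2 a J2 -> expansion h3 a J3 ->
  J3 = J1 *m J2.
Proof.
move=> aX h1a h2a h1X h21 [J1C H1] [J2C H2] [J3C H3].
have Xa := nbhs_singleton aX.
have h3a : h3 a = a by rewrite -h21// h1a.
have bJ (v : E) (J : 'M[R]_m) :
    (forall i j, `|J i j| <= C) -> `|v *m J| <= m%:R * C * `|v|.
  exact: norm_mulmx.
have main (v : E) : v *m (J1 *m J2 - J3) = 0.
  apply/eqP; rewrite -normr_le0.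
  have [d /= d0 dX] : exists2 d : R, 0 < d & forall x, `|x - a| < d -> X x.
    have /nbhs_ballP[d /= d0 dX] := aX.
    by exists d => // x xd; apply: dX; rewrite -ball_normE/= distrC.
  pose L := m%:R * C + C * delta.
  have mC : 0 <= m%:R * C by rewrite mulr_ge0.
  have L0 : 0 <= L by rewrite addr_ge0// mulr_ge0// ltW.
  pose n := `|v|.
  pose K := C * L ^+ 2 * n ^+ 2 + m%:R * C * (C * n ^+ 2) + C * n ^+ 2.
  pose t0 := Num.min (d / (n + 1)) (delta / ((L + 1) * (n + 1))).
  have n0 : 0 <= n by exact: normr_ge0.
  have Ln0 : 0 < (L + 1) * (n + 1) by rewrite mulr_gt0 ?ltr_wpDl.
  have t00 : 0 < t0 by rewrite lt_min !divr_gt0 ?ltr_wpDl.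
  have small t : 0 < t -> t < t0 -> `|v *m (J1 *m J2 - J3)| <= K * t.
    move=> tp; rewrite lt_min !ltr_pdivlMr ?ltr_wpDl// => /andP[td tdelta].
    have tn : 0 <= t * n by rewrite mulr_ge0// ltW.
    have xa : `|(a + t *: v) - a| = t * n.
      by rewrite addrC addKr normrZ gtr0_norm.
    have Xx : X (a + t *: v) by apply: dX; rewrite xa; lra.
    have aa r : 0 <= r -> `|a - a| <= r by rewrite subrr normr0.
    have tdel : t * n <= delta.
      have : 0 <= L * (t * n) by rewrite mulr_ge0.
      have : 0 <= L * t by rewrite mulr_ge0// ltW.
      by lra.
    have := H1 (t * n) _ a Xx Xa tdel; rewrite xa lexx h1a => /(_ isT (aa _ tn)).
    have := H3 (t * n) _ a Xx Xa tdel; rewrite xa lexx h3a => /(_ isT (aa _ tn)).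
    have -> : a + t *: v - a = t *: v by rewrite addrC addKr.
    rewrite -!scalemxAl -h21//.
    set x := a + t *: v => e3 e1.
    have h1x : `|h1 x - a| <= L * (t * n).
      have := ler_normD (h1 x - a - t *: (v *m J1)) (t *: (v *m J1)).
      rewrite subrK normrZ gtr0_norm// => H.
      have := ler_wpM2l (ltW tp) (bJ v J1 J1C).
      have : C * (t * n) * (t * n) <= C * delta * (t * n).
        by rewrite ler_wpM2r// ler_wpM2l.
      rewrite /L -/n; lra.
    have Lt : L * (t * n) <= delta.
      have : 0 <= L * t by rewrite mulr_ge0// ltW.
      lra.
    have := H2 (L * (t * n)) _ a (h1X _ Xx) Xa Lt h1x.
    rewrite h2a => /(_ (aa _ (mulr_ge0 L0 tn))) e2.
    have e2' : `|h2 (h1 x) - a - (h1 x - a) *m J2| <= C * L ^+ 2 * n ^+ 2 * t ^+ 2.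
      apply: le_trans e2 _.
      have -> : C * L ^+ 2 * n ^+ 2 * t ^+ 2 =
        C * (L * (t * n)) * (L * (t * n)) by ring.
      by apply: ler_wpM2l h1x; apply: mulr_ge0 => //; exact: mulr_ge0.
    have e1' := le_trans (bJ _ _ J2C) (ler_wpM2l mC e1).
    rewrite -(ler_pM2l tp) -[in leLHS](gtr0_norm tp) -normrZ.
    have -> : t *: (v *m (J1 *m J2 - J3)) =
        (h2 (h1 x) - a - t *: (v *m J3)) - (h2 (h1 x) - a - (h1 x - a) *m J2) -
        (h1 x - a - t *: (v *m J1)) *m J2.
      rewrite mulmxBr scalerBr mulmxA.
      rewrite [X in _ = _ - X]mulmxBl -[(t *: _) *m J2]scalemxAl.
      move: (v *m J1 *m J2) ((h1 x - a) *m J2) (v *m J3) => p q u.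
      by apply/rowP => i; rewrite !mxE; ring.
    apply: le_trans (ler_normB _ _) _.
    have := ler_normB (h2 (h1 x) - a - t *: (v *m J3))
      (h2 (h1 x) - a - (h1 x - a) *m J2).
    rewrite /K; nra.
  apply/ler_addgt0Pr => e e0; rewrite add0r.
  have K0 : 0 <= K by rewrite !addr_ge0 ?mulr_ge0// ?sqr_ge0.
  pose t := Num.min (t0 / 2) (e / (K + 1)).
  have tp : 0 < t by rewrite lt_min !divr_gt0// ltr_wpDl.
  have tt0 : t < t0.
    by apply: (@le_lt_trans _ _ (t0 / 2)); [rewrite ge_min lexx|lra].
  apply: le_trans (small t tp tt0) _.
  have : t <= e / (K + 1) by rewrite ge_min lexx orbT.
  rewrite ler_pdivlMr ?ltr_wpDl//; lra.
apply/eqP; rewrite eq_sym -subr_eq0; apply/eqP/row_matrixP => i.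
by rewrite rowE main row0.
Qed.

Variable H : set (E -> E).
Hypothesis openX : open X.
Hypothesis H_stable : forall f x, H f -> X x -> X (f x).
Hypothesis H_id : H id.
Hypothesis H_comp : forall f g, H f -> H g -> H (f \o g).
Hypothesis H_inv : forall f, H f -> exists2 g, H g &
  forall x, X x -> g (f x) = x /\ f (g x) = x.
Hypothesis H_expansion : forall f a, H f -> X a -> exists J, expansion f a J.

(** By the chain rule, the coefficients of the powers of an inverse of f are
inverse to those of the powers of f.  Multiplying the expansion of a power of f by
them turns it into a perturbation of the identity of relative size
m C^2 r, which is at most 1/2 for r <= 1 / (2 m C^2 + 1). *)
Lemma nearby_fixed_points_not_isolated : exists2 d : R, 0 < d &
  forall f a b, H f -> X a -> X b -> f a = a -> f b = b -> b != a ->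
    `|b - a| <= d -> forall e, 0 < e ->
    exists z, [/\ X z, z != a, `|z - a| < e & f z = z].
Proof.
pose s := 2 * (m%:R * C * C) + 1.
have mCC : 0 <= m%:R * C * C by rewrite !mulr_ge0.
have s0 : 0 < s by rewrite /s; lra.
exists (Num.min delta s^-1); first by rewrite lt_min delta0 invr_gt0.
move=> f a b Hf Xa Xb fa fb ba bad e e0.
have nX : nbhs a X by exact: open_nbhs_nbhs.
have [g Hg fg] := H_inv Hf.
have ga : g a = a by rewrite -{1}fa (fg a Xa).1.
have H_iter h j : H h -> H (iter j h).
  by move=> Hh; elim: j => // j IH; exact: H_comp IH.
have iter_fix h j : h a = a -> iter j h a = a by move=> ha; elim: j => //= j ->.
have [A HA] := H_expansion Hf Xa.
have /choice[B HB] : forall j, exists J, expansion (iter j g) a J.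
  by move=> j; apply: H_expansion => //; exact: H_iter.
have stable h j x : H h -> X x -> X (iter j h x).
  by move=> Hh; exact: H_stable (H_iter _ _ Hh).
have id1 : expansion id a 1%:M.
  split=> [i j|r x y _ _ _ xa _]; rewrite ?mxE ?normr_nat.
    by apply: le_trans C1; case: eqP.
  by rewrite mulmx1 subrr normr0 !mulr_ge0// (le_trans _ xa).
have B0 : B 0%N = 1%:M.
  rewrite -[RHS]mulmx1.
  exact: (expansion_comp nX _ _ _ _ id1 id1 (HB 0%N)).
have BA j : B j.+1 *m A = B j.
  apply/esym; apply: expansion_comp (HB j.+1) HA (HB j) => //.
  - exact: iter_fix.
  - by move=> x Xx; exact: stable.
  - by move=> x Xx; rewrite iterS (fg _ (stable _ _ _ Hg Xx)).2.
apply: (other_fixed_points_nearby (r := Num.min delta s^-1) B0 BA (b := b)) => //.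
  by move=> x Xx; exact: H_stable.
have gf j z : X z -> iter j g (iter j f z) = z.
  move=> Xz; elim: j => // j IH.
  by rewrite [iter j.+1 f z]iterS iterSr (fg _ (stable _ _ _ Hf Xz)).1.
move=> j x y Xx Xy xa ya.
have [F HF] := H_expansion (H_iter f j Hf) Xa.
have FB : 1%:M = F *m B j.
  apply: expansion_comp HF (HB j) id1 => //.
  - exact: iter_fix.
  - exact: iter_fix.
  - by move=> z Xz; exact: stable.
  - by move=> z Xz; exact: gf.
have -> : (iter j f x - iter j f y) *m B j - (x - y) =
    (iter j f x - iter j f y - (x - y) *m F) *m B j.
  by rewrite [RHS]mulmxBl -[(x - y) *m F *m B j]mulmxA -FB mulmx1.
apply: le_trans (norm_mulmx _ C0 (HB j).1) _.
have rd : Num.min delta s^-1 <= delta by rewrite ge_min lexx.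
have := HF.2 _ _ _ Xx Xy rd xa ya => /(ler_wpM2l (mulr_ge0 (ler0n _ m) C0)).
move=> /le_trans; apply; rewrite !mulrA ler_wpM2r//.
apply: (@le_trans _ _ (m%:R * C * C * s^-1)).
  by rewrite ler_wpM2l// ge_min lexx orbT.
by rewrite ler_pdivrMr// /s; lra.
Qed.
End Group.

(** * Real coordinates on complex space *)

Section Coordinates.
Context {R : realType} {n : nat}.
Local Notation Cn := 'rV[R[i]]_n.
Local Notation coords := ('I_n * bool)%type.
Local Notation E := 'rV[R]_#|{: coords}|.
Implicit Types (c : coords) (z w : Cn) (u : E).

Definition realify z : E := \row_k real_coord (enum_val k) z.

Definition complexify u : Cn :=
  \row_j (u 0 (enum_rank (j, false)) +i* u 0 (enum_rank (j, true))).

Lemma realifyE z c : realify z 0 (enum_rank c) = real_coord c z.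
Proof. by rewrite mxE enum_rankK. Qed.

Lemma real_coord_complexify c u : real_coord c (complexify u) = u 0 (enum_rank c).
Proof. by case: c => j []; rewrite /real_coord mxE. Qed.

Lemma realifyK : cancel realify complexify.
Proof.
move=> z; apply/rowP => j; rewrite mxE !realifyE /real_coord /=.
by case: (z 0 j).
Qed.

Lemma complexifyK : cancel complexify realify.
Proof.
by move=> u; apply/rowP => k; rewrite mxE real_coord_complexify enum_valK.
Qed.

Lemma real_coordB c z w : real_coord c (z - w) = real_coord c z - real_coord c w.
Proof. by rewrite /real_coord !mxE; case: (c.2); rewrite raddfB. Qed.

Lemma real_coordD c z w : real_coord c (z + w) = real_coord c z + real_coord c w.
Proof. by rewrite /real_coord !mxE; case: (c.2); rewrite raddfD. Qed.

Lemma real_coord_dir c c' (t : R) :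
  real_coord c (t%:C *: rdir c') = t * (c == c')%:R.
Proof.
case: c c' => [j b] [j' b']; rewrite /real_coord /rdir !mxE/= xpair_eqE.
have [_|_] := eqVneq j j'; last by rewrite !mulr0; case: b => /=; rewrite ?mulr0.
by case: b; case: b'; rewrite /=; ring.
Qed.

Lemma realifyB z w : realify (z - w) = realify z - realify w.
Proof. by apply/rowP => k; rewrite !mxE real_coordB. Qed.

Lemma realify_shift c z (t : R) :
  realify (z + t%:C *: rdir c) = realify z + t *: delta_mx 0 (enum_rank c).
Proof.
apply/rowP => k; rewrite !mxE real_coordD real_coord_dir eqxx /=.
by rewrite (can2_eq enum_valK enum_rankK).
Qed.

Lemma dist_shift c z (t : R) : `|realify (z + t%:C *: rdir c) - realify z| <= `|t|.
Proof.
rewrite realify_shift addrC addKr; apply: norm_row_le => // k.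
rewrite !mxE eqxx /= normrM.
by case: eqP => _; rewrite ?normr1 ?normr0 ?mulr1 ?mulr0.
Qed.

Lemma coord_dist c z w : `|real_coord c z - real_coord c w| <= `|realify z - realify w|.
Proof.
have := norm_entry (realify (z - w)) 0 (enum_rank c).
by rewrite realifyE real_coordB realifyB.
Qed.

Lemma complex_norm_lt (x : R[i]) (e : R) : 0 < e ->
  `|complex.Re x| < e / 2 -> `|complex.Im x| < e / 2 -> `|x| < e%:C.
Proof.
move=> e0; rewrite !ltr_norml => /andP[a1 a2] /andP[b1 b2].
rewrite normc_def ltcR -(ger0_norm (ltW e0)) -sqrtr_sqr ltr_sqrt; nra.
Qed.

Lemma complex_parts_lt (x : R[i]) (e : R) :
  `|x| < e%:C -> `|complex.Re x| < e /\ `|complex.Im x| < e.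
Proof.
rewrite normc_def ltcR => xe.
have e0 : 0 < e by exact: le_lt_trans (sqrtr_ge0 _) xe.
move: xe; rewrite -{1}(ger0_norm (ltW e0)) -sqrtr_sqr ltr_sqrt; last by nra.
by move=> H; rewrite !ltr_norml; split; apply/andP; split; nra.
Qed.

Lemma nbhs_realify z (A : set Cn) : nbhs z A <->
  exists2 e : R, 0 < e & forall w, `|realify w - realify z| < e -> A w.
Proof.
split=> [/nbhs_ballP[e /= e0 eA]|[e e0 eA]].
  have [eI eR] : complex.Im e = 0 /\ 0 < complex.Re e.
    by move: e0; rewrite ltcE /= => /andP[/eqP -> ->].
  have eE : e = (complex.Re e)%:C by case: (e) eI => a b /= ->.
  exists (complex.Re e / 2); first by rewrite divr_gt0.
  move=> w zw; apply: eA; split => // i j; rewrite (ord1 i).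
  suff : `|z 0 j - w 0 j| < e by [].
  rewrite eE; apply: complex_norm_lt => //; rewrite raddfB.
    by apply: le_lt_trans zw; rewrite distrC; exact: (coord_dist (j, false)).
  by apply: le_lt_trans zw; rewrite distrC; exact: (coord_dist (j, true)).
apply/nbhs_ballP; exists e%:C => /=; first by rewrite ltcR.
move=> w [_ zw]; apply: eA.
apply: norm_row_lt => // k; rewrite -realifyB mxE real_coordB distrC.
case: (enum_val k) => j b.
have : `|z 0 j - w 0 j| < e%:C by exact: zw.
by move=> /complex_parts_lt; rewrite !raddfB => -[? ?]; case: b.
Qed.

Lemma open_realify (U : set Cn) z : open U -> U z ->
  exists2 e : R, 0 < e & forall w, `|realify w - realify z| < e -> U w.
Proof. by move=> oU Uz; apply/nbhs_realify; exact: open_nbhs_nbhs. Qed.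

Lemma continuous_realify (g : Cn -> R) z : {for z, continuous g} <->
  forall e : R, 0 < e -> exists2 d : R, 0 < d &
    forall w, `|realify w - realify z| < d -> `|g w - g z| < e.
Proof.
have key := @cvgrPdist_lt _ _ _ (nbhs z) (nbhs_filter z) g (g z).
split=> [/key gz e e0|gz].
  have [d d0 dA] := (nbhs_realify z _).1 (gz e e0).
  by exists d => // w /dA /=; rewrite distrC.
apply/key => e e0; have [d d0 dA] := gz e e0.
by apply/nbhs_realify; exists d => // w /dA; rewrite distrC.
Qed.

Lemma complexify_continuous : continuous complexify.
Proof.
move=> u A /nbhs_realify[e e0 eA]; apply/nbhs_ballP; exists e => //= w.
by rewrite -ball_normE /= => uw; apply: eA; rewrite !complexifyK distrC.
Qed.

Lemma closure_realify (D : set Cn) z : closure D z ->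
  forall e : R, 0 < e -> exists2 w, D w & `|realify w - realify z| < e.
Proof.
move=> clz e e0.
have /clz[w [Dw wz]] : nbhs z [set w | `|realify w - realify z| < e].
  by apply/nbhs_realify; exists e.
by exists w.
Qed.

Lemma bounded_realify (D : set Cn) : bounded_set D ->
  exists2 M : R, 0 < M & forall z, D z -> `|realify z| <= M.
Proof.
move=> [M [Mreal DM]].
have [MI MR] : M = (complex.Re M)%:C /\ complex.Im M = 0.
  move: Mreal; rewrite realE !lecE; case: (M) => a b /=.
  by case/orP => /andP[/eqP ? _]; split => //; congr (_ +i* _).
pose N := `|complex.Re M| + 1.
have N0 : 0 < N by rewrite ltr_wpDl.
have MN : M < N%:C.
  by rewrite MI ltcR /N; have := ler_norm (complex.Re M); lra.
exists (N + 1); first by rewrite addr_gt0.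
move=> z Dz; apply: norm_row_le => [|k]; first by rewrite addr_ge0 // ltW.
have zN : `|z| < (N + 1)%:C.
  by apply: le_lt_trans (DM _ MN _ Dz) _; rewrite ltcR ltrDl.
have : ball z (N + 1)%:C 0 by rewrite -ball_normE /= subr0.
move=> [_ zb]; rewrite mxE; case: (enum_val k) => j b.
have : `|z 0 j - (0 : Cn) 0 j| < (N + 1)%:C by exact: zb.
rewrite mxE subr0 => /complex_parts_lt[? ?].
by apply: ltW; case: b.
Qed.

Lemma compact_realify_ball (p : Cn) (r : R) :
  compact [set q | `|realify q - realify p| <= r].
Proof.
have cB : compact (complexify @` closed_ball_ (fun u : E => `|u|)
    (realify p) r).
  apply: continuous_compact.
    by apply: continuous_subspaceT => u; exact: complexify_continuous.
  apply: bounded_closed_compact; last exact: closed_closed_ball_.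
  exists (`|realify p| + r); split; first exact: num_real.
  move=> N MN u; rewrite /closed_ball_ /= => uM.
  have := ler_distD (realify p) u 0; rewrite !subr0 distrC.
  lra.
congr compact : cB; apply/seteqP; split=> [_ [u up <-]|q qp] /=.
  by rewrite complexifyK distrC.
by exists (realify q); [rewrite /closed_ball_/= distrC|exact: realifyK].
Qed.

Lemma compact_closure (D : set Cn) : bounded_set D -> compact (closure D).
Proof.
move=> /bounded_realify[M M0 DM].
apply: subclosed_compact (@compact_realify_ball 0 (M + `|realify 0| + 1)) _.
  exact: closed_closure.
move=> z /closure_realify/(_ 1 ltr01)[w Dw wz] /=.
apply: le_trans (ler_distD (realify w) _ _) _.
have := ler_normB (realify w) (realify 0); have := DM w Dw.
by rewrite [`|realify z - _|]distrC; lra.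
Qed.

End Coordinates.

(** * Mean value estimates for partial derivatives *)

Section PartialDerivatives.
Context {R : realType} {n : nat}.
Local Notation Cn := 'rV[R[i]]_n.
Local Notation coords := ('I_n * bool)%type.
Local Notation E := 'rV[R]_#|{: coords}|.
Implicit Types (c : coords) (z w : Cn) (g : Cn -> R).

Lemma shift0 c z : z + 0%:C *: rdir c = z.
Proof. by rewrite scale0r addr0. Qed.

Lemma is_derive_slice c g z (s : R) : pderivable c g (z + s%:C *: rdir c) ->
  is_derive s 1 (slice c g z) (pderiv c g (z + s%:C *: rdir c)).
Proof.
rewrite /pderivable /pderiv.
have -> : slice c g (z + s%:C *: rdir c) = (fun t => slice c g z (t + s)).
  by apply/funext => t; rewrite /slice -addrA -scalerDl -raddfD [(s + t)%R]addrC.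
rewrite derive1E => dg.
have dE : (fun h : R => h^-1 *: ((slice c g z \o shift s) (h *: 1) - slice c g z s)) =
  (fun h : R => h^-1 *: (((fun t => slice c g z (t + s)) \o shift 0) (h *: 1) -
     slice c g z (0 + s))).
  by apply/funext => h; rewrite /= addr0 add0r.
split; first by rewrite /derivable dE.
rewrite /derive dE.
reflexivity.
Qed.

Lemma coord_MVT c g z (t : R) :
  (forall a : R, 0 <= a <= 1 -> pderivable c g (z + (a * t)%:C *: rdir c)) ->
  exists2 a : R, 0 <= a <= 1 & g (z + t%:C *: rdir c) - g z =
    t * pderiv c g (z + (a * t)%:C *: rdir c).
Proof.
move=> dg; pose F (a : R) := slice c g z (a * t).
have dF (a : R) : a \in `[0, 1] ->
    is_derive a 1 F (t * pderiv c g (z + (a * t)%:C *: rdir c)).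
  rewrite in_itv /= => a01; have := is_derive_slice (dg a a01) => dsl.
  have dm : is_derive a 1 (fun a : R => a * t) t.
    have -> : (fun a : R => a * t) = t *: (id : R -> R).
      by apply/funext => b; rewrite /= mulrC.
    by apply: is_derive_eq; rewrite scaler1.
  rewrite [t * _]mulrC; exact: (@is_derive1_comp _ (slice c g z) (fun a => a * t)).
have cF : {within `[0, 1], continuous F}.
  by apply: derivable_within_continuous => a /dF[].
have dF' (a : R) : a \in `]0, 1[ ->
    is_derive a 1 F (t * pderiv c g (z + (a * t)%:C *: rdir c)).
  by move=> a01; apply: dF; exact: subset_itv_oo_cc.
have [a] := MVT_segment ler01 dF' cF.
rewrite in_itv /= subr0 mulr1 => a01.
by rewrite /F /slice mul1r mul0r shift0 => aE; exists a.
Qed.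

Lemma coord_lipschitz c g z (t M : R) :
  (forall a : R, 0 <= a <= 1 -> pderivable c g (z + (a * t)%:C *: rdir c) /\
     `|pderiv c g (z + (a * t)%:C *: rdir c)| <= M) ->
  `|g (z + t%:C *: rdir c) - g z| <= M * `|t|.
Proof.
move=> dg; have [a a01|a a01 ->] := coord_MVT (c := c) (g := g) (z := z) (t := t).
  exact: (dg a a01).1.
by rewrite normrM mulrC ler_wpM2r// (dg a a01).2.
Qed.

Let row_shift (u : E) (t : R) k k' :
  (u + t *: delta_mx 0 k') 0 k = u 0 k + t * (k == k')%:R.
Proof. by rewrite !mxE eqxx. Qed.

(* The vertices of the path: the first k coordinates are those of y. *)
Let stair (x y : Cn) (k : nat) : Cn := complexify
  (\row_i (if (i < k)%N then realify y 0 i else realify x 0 i)).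

(** Going from x to y by moving one real coordinate at a time stays in the box
and uses only partial derivatives. *)
Lemma box_lipschitz g (M : R) x y :
  (forall z, `|realify z - realify x| <= `|realify y - realify x| ->
     forall c, pderivable c g z /\ `|pderiv c g z| <= M) ->
  `|g y - g x| <= #|{: coords}|%:R * M * `|realify y - realify x|.
Proof.
move=> dg; set d := `|realify y - realify x|.
have d0 : 0 <= d by exact: normr_ge0.
suff H k : (k <= #|{: coords}|)%N -> `|g (stair x y k) - g x| <= k%:R * M * d.
  have yE : stair x y #|{: coords}| = y.
    rewrite /stair -[RHS]realifyK; congr complexify.
    by apply/rowP => i; rewrite mxE ltn_ord.
  by have := H _ (leqnn _); rewrite yE.
elim: k => [_|k IH km].
  rewrite (_ : stair x y 0 = x) ?subrr ?normr0 ?mul0r//.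
  by rewrite /stair -[RHS]realifyK; congr complexify; apply/rowP => i; rewrite mxE.
pose ik := Ordinal km; pose c := enum_val ik.
pose t := realify y 0 ik - realify x 0 ik.
have td : `|t| <= d.
  by have := norm_entry (realify y - realify x) 0 ik; rewrite row_subE.
have Sk : stair x y k.+1 = stair x y k + t%:C *: rdir c.
  apply: (can_inj realifyK); rewrite realify_shift !complexifyK /c enum_valK.
  apply/rowP => i; rewrite row_shift [LHS]mxE [X in _ = X + _]mxE.
  rewrite ltnS leq_eqVlt -[i == k :> nat]/(i == ik).
  have [-> /=|ik' /=] := eqVneq i ik; last by rewrite mulr0 addr0.
  by rewrite ltnn mulr1 /t addrC subrK.
have -> : k.+1%:R * M * d = M * d + k%:R * M * d by rewrite -natr1; ring.
have -> : g (stair x y k.+1) - g x =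
    (g (stair x y k.+1) - g (stair x y k)) + (g (stair x y k) - g x).
  by rewrite addrA subrK.
apply: le_trans (ler_normD _ _) _; apply: lerD; last exact/IH/ltnW.
have box (a : R) : 0 <= a <= 1 ->
    `|realify (stair x y k + (a * t)%:C *: rdir c) - realify x| <= d.
  move=> /andP[a0 a1]; rewrite realify_shift complexifyK /c enum_valK.
  apply: norm_row_le => // i.
  have di := norm_entry (realify y - realify x) 0 i.
  rewrite row_subE row_shift [X in `|X + _ - _|]mxE.
  have [-> /=|_ /=] := eqVneq i ik.
    rewrite ltnn mulr1 [_ + a * t]addrC addrK normrM ger0_norm//.
    by apply: le_trans td; rewrite ler_piMl.
  rewrite mulr0 addr0; case: ifP => _; last by rewrite subrr normr0.
  by rewrite -row_subE.
rewrite Sk; apply: le_trans (coord_lipschitz (M := M) _) _.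
  by move=> a a01; exact: dg (box _ a01) c.
have M0 : 0 <= M.
  have /(_ c)[_] : forall c, pderivable c g x /\ `|pderiv c g x| <= M.
    by apply: dg; rewrite subrr normr0.
  exact: le_trans.
by rewrite ler_wpM2l.
Qed.

Lemma pderiv_near c g1 g2 z : (\forall w \near z, g1 w = g2 w) ->
  pderiv c g1 z = pderiv c g2 z /\ (pderivable c g1 z -> pderivable c g2 z).
Proof.
move=> /nbhs_realify[e e0 g12].
have sl : \forall t \near (0 : R), slice c g1 z t = slice c g2 z t.
  apply/nbhs_ballP; exists e => //= t; rewrite -ball_normE /= sub0r normrN => te.
  by apply: g12; apply: le_lt_trans (dist_shift _ _ _) te.
rewrite /pderiv !derive1E; split; first exact: near_eq_derive.
exact: near_eq_derivable.
Qed.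

Lemma pderivs_near s g1 g2 z : (\forall w \near z, g1 w = g2 w) ->
  \forall w \near z, pderivs s g1 w = pderivs s g2 w.
Proof.
elim: s => // c s IH /IH /near_join; apply: filterS => w gw /=.
exact: (pderiv_near _ gw).1.
Qed.

Definition linear_form (a : coords -> R) z : R := \sum_c a c * real_coord c z.

Lemma linear_form_shift a c z (t : R) :
  linear_form a (z + t%:C *: rdir c) = linear_form a z + t * a c.
Proof.
rewrite /linear_form [in RHS](bigD1 c) //= [in LHS](bigD1 c) //=.
rewrite real_coordD real_coord_dir eqxx mulr1 mulrDr.
rewrite [X in _ + X = _](eq_bigr (fun c' => a c' * real_coord c' z)).
  by rewrite -!addrA; congr (_ + _); rewrite addrC [t * _]mulrC.
by move=> c' cc'; rewrite real_coordD real_coord_dir (negbTE cc') mulr0 addr0.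
Qed.

Lemma pderiv_sub_linear a c g z : pderivable c g z ->
  pderivable c (fun w => g w - linear_form a w) z /\
  pderiv c (fun w => g w - linear_form a w) z = pderiv c g z - a c.
Proof.
move=> dg; have slE : slice c (fun w => g w - linear_form a w) z =
    slice c g z - (cst (linear_form a z) + a c *: (id : R -> R)).
  by apply/funext => t; rewrite /slice linear_form_shift /= [t * _]mulrC.
have dslice : is_derive (0 : R) 1 (slice c g z) (pderiv c g z).
  by apply: DeriveDef dg _; rewrite /pderiv derive1E.
have dlin : is_derive (0 : R) 1 (cst (linear_form a z) + a c *: (id : R -> R)) (a c).
  have := is_deriveD (is_derive_cst (linear_form a z) (0 : R) (1 : R))
    (is_deriveZ (a c) (is_derive_id (0 : R) (1 : R))).
  by rewrite add0r scaler1.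
have D := is_deriveB dslice dlin.
rewrite -slE in D.
case: D => D1 D2; split; first exact: D1.
by rewrite {1}/pderiv derive1E; exact: D2.
Qed.

End PartialDerivatives.

(** * Quasi-convexity of smoothly bounded domains *)

Section QuasiConvexity.
Context {R : realType} {n : nat}.
Local Notation Cn := 'rV[R[i]]_n.
Local Notation coords := ('I_n * bool)%type.
Local Notation m := #|{: coords}|.
Local Notation E := 'rV[R]_m.
Implicit Types (c : coords) (z w a b p : Cn) (g r : Cn -> R) (D U : set Cn).

Definition grad_le M g z := forall c, pderivable c g z /\ `|pderiv c g z| <= M.

(** The consequence of quasi-convexity that is used below: if [a] and [b] are
joined in [D] by a path of length at most K |b - a| that is piecewise parallel
to the axes, a bound on the partial derivatives of [g] along it gives the
conclusion.  Quantifying over [g] avoids handling paths, and restricting the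
hypothesis to points near [a] makes the property apply to first order
remainders. *)
Definition quasi_convex_at D (K : R) a := forall b, D b ->
  `|realify b - realify a| < K^-1 -> forall g M, 0 <= M ->
  (forall z, D z -> `|realify z - realify a| <= K * `|realify b - realify a| ->
     grad_le M g z) ->
  `|g b - g a| <= K * M * `|realify b - realify a|.

Lemma quasi_convex_interior D p : open D -> D p ->
  exists K0 : R, exists2 e : R, 0 < e &
  forall a, `|realify a - realify p| < e ->
    forall K, K0 <= K -> quasi_convex_at D K a.
Proof.
move=> oD Dp; have [e e0 eD] := open_realify oD Dp.
pose K0 : R := Num.max (m%:R + 1) (2 / e).
exists K0, (e / 2); first by rewrite divr_gt0.
move=> a ap K; rewrite ge_max => /andP[mK eK] b Db ba g M M0 gM.
have m0 : 0 <= m%:R :> R by [].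
have d0 : 0 <= `|realify b - realify a| by [].
have ba2 : `|realify b - realify a| < e / 2.
  apply: lt_le_trans ba _; rewrite -[e / 2]invrK lef_pV2 ?posrE ?invr_gt0 ?divr_gt0//.
  - by rewrite invf_div.
  - by apply: lt_le_trans mK; lra.
apply: le_trans (box_lipschitz (M := M) _) _.
  move=> z zb; apply: gM.
    apply: eD; apply: le_lt_trans (ler_distD (realify a) _ _) _.
    by lra.
  apply: le_trans zb _; rewrite ler_peMl//; lra.
rewrite ler_wpM2r// ler_wpM2r//; lra.
Qed.

(** Near a boundary point the domain is the set r < 0, and in some direction of
a coordinate axis r decreases at a speed at least k > 0.  Move both [a] and [b] by
l |b - a| in that direction: r has then dropped by at least m L |b - a|, which is
as much as it can increase in a box of radius |b - a|, L being a bound for its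
partial derivatives.  The shifted points are therefore joined by a
staircase inside the domain. *)
Lemma quasi_convex_boundary D p : smooth_boundary D -> (closure D `\` D) p ->
  exists K0 : R, exists2 e : R, 0 < e &
  forall a, `|realify a - realify p| < e -> D a ->
    forall K, K0 <= K -> quasi_convex_at D K a.
Proof.
move=> bD /bD[U [r [[oU Up] rS rU UD]]].
have [c rc] := rU p Up.
(* Half of the speed at p, to leave room for nearby points. *)
pose k := `|pderiv c r p| / 2.
have k0 : 0 < k by rewrite divr_gt0// normr_gt0.
pose L := \sum_c' `|pderiv c' r p| + 1.
have L0 : 0 <= L by rewrite addr_ge0// sumr_ge0.
have contr c' : {for p, continuous (pderiv c' r)} by exact: (rS [:: c'] p Up).1.
have [e e0 eP] : exists2 e : R, 0 < e & forall z, `|realify z - realify p| < e ->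
    [/\ U z, forall c', `|pderiv c' r z| <= L & `|pderiv c r z - pderiv c r p| < k].
  apply/nbhs_realify.
  have rU' : nbhs p U by exact: open_nbhs_nbhs.
  have rL : \forall z \near p, forall c', `|pderiv c' r z| <= L.
    apply: (@filter_forall _ _ (fun c' => [set z | `|pderiv c' r z| <= L])
      (nbhs p) (nbhs_filter p)) => c'.
    apply/nbhs_realify.
    have [d d0 dP] := (continuous_realify _ _).1 (contr c') 1 ltr01.
    exists d => // z /dP zp.
    have : `|pderiv c' r p| <= \sum_c'' `|pderiv c'' r p|.
      by rewrite (bigD1 c') //= lerDl sumr_ge0.
    have := ler_distD (pderiv c' r p) (pderiv c' r z) 0.
    rewrite /= !subr0 /L; lra.
  have rk : \forall z \near p, `|pderiv c r z - pderiv c r p| < k.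
    by apply/nbhs_realify; exact: (continuous_realify _ _).1 (contr c) k k0.
  by apply: (@filterS3 _ (nbhs p) (nbhs_filter p)) rU' rL rk => z; split.
(* The sense along the axis in which r decreases. *)
pose sg : R := - Num.sg (pderiv c r p).
have sg1 : `|sg| = 1 by rewrite normrN normr_sg rc.
have descent z : `|realify z - realify p| < e -> sg * pderiv c r z <= - k.
  move=> /eP[_ _]; rewrite -[ltLHS]mul1r -{1}sg1 -normrM mulrBr ltr_norml.
  have : sg * pderiv c r p = - (2 * k).
    by rewrite /sg mulNr -normrEsg /k mulrC divfK.
  by move=> -> /andP[_]; lra.
(* k * l = m * L balances the descent and the variation of r in a box. *)
pose l := m%:R * L / k.
have l0 : 0 <= l by rewrite divr_ge0 ?mulr_ge0// ltW.
pose K0 : R := Num.max (2 * l + m%:R + 1) (3 * (1 + l) / e).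
exists K0, (e / 3); first by rewrite divr_gt0.
move=> a ap Da K; rewrite ge_max => /andP[mK eK] b Db ba g M M0 gM.
have m0 : 0 <= m%:R :> R by [].
set d := `|realify b - realify a| in ba gM *.
have d0 : 0 <= d by exact: normr_ge0.
have K_gt0 : 0 < K by clear -n mK l0 m0; lra.
have lK : 1 + l <= K by clear -n mK l0 m0; lra.
have ld : (1 + l) * d < e / 3.
  have dK : d * K < 1 by rewrite -ltr_pdivlMr// div1r.
  have : d * (3 * (1 + l) / e) < 1 by apply: le_lt_trans dK; rewrite ler_wpM2l.
  by rewrite mulrA ltr_pdivrMr//; clear -n; lra.
have dE : d <= (1 + l) * d by rewrite ler_peMl// lerDl.
pose v := sg * (l * d).
have vE : `|v| = l * d by rewrite normrM sg1 mul1r ger0_norm// mulr_ge0.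
have av (t : R) : 0 <= t <= 1 -> `|t * v| <= l * d.
  by move=> /andP[t0 t1]; rewrite normrM vE ger0_norm// ler_piMl// mulr_ge0.
have slide x (t : R) : `|realify x - realify a| <= d -> 0 <= t <= 1 ->
    `|realify (x + (t * v)%:C *: rdir c) - realify a| <= (1 + l) * d.
  move=> xa t01; apply: le_trans (ler_distD (realify x) _ _) _.
  have := dist_shift c x (t * v); have := av t t01; clear -n xa; lra.
have close x : `|realify x - realify a| <= (1 + l) * d ->
    `|realify x - realify p| < e.
  move=> xa; apply: le_lt_trans (ler_distD (realify a) _ _) _.
  by clear -n xa ap ld e0; lra.
have slide_r x (t : R) : `|realify x - realify a| <= d -> 0 <= t <= 1 ->
    r (x + (t * v)%:C *: rdir c) <= r x - k * (t * (l * d)).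
  move=> xa t01.
  have sclose (s : R) : 0 <= s <= 1 ->
      `|realify (x + (s * (t * v))%:C *: rdir c) - realify p| < e.
    case/andP: t01 => t0 t1 /andP[s0 s1].
    by apply: close; rewrite mulrA; apply: slide => //; rewrite mulr_ge0//= mulr_ile1.
  have [s s01|s s01] := coord_MVT (c := c) (g := r) (z := x) (t := t * v).
    by have [Us _ _] := eP _ (sclose s s01); exact: (rS [::] _ Us).2 c.
  have t0 : 0 <= t by case/andP: t01.
  have := ler_wpM2l (mulr_ge0 t0 (mulr_ge0 l0 d0)) (descent _ (sclose s s01)).
  rewrite /v; clear -n; lra.
have slide_D x (t : R) : D x -> `|realify x - realify a| <= d -> 0 <= t <= 1 ->
    D (x + (t * v)%:C *: rdir c).
  move=> Dx xa t01.
  have [Us _ _] := eP _ (close _ (slide _ _ xa t01)).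
  apply/UD => //; apply: le_lt_trans (slide_r _ _ xa t01) _.
  have [Ux _ _] := eP x (close _ (le_trans xa dE)).
  have := (UD x Ux).1 Dx.
  have : 0 <= k * (t * (l * d)).
    by case/andP: t01 => ? ?; do ?[apply: mulr_ge0 => //]; exact: ltW.
  by clear -n; lra.
have aa : `|realify a - realify a| <= d by rewrite subrr normr0.
pose a' := a + v%:C *: rdir c; pose b' := b + v%:C *: rdir c.
have gslide x : D x -> `|realify x - realify a| <= d ->
    `|g (x + v%:C *: rdir c) - g x| <= M * (l * d).
  move=> Dx xa; rewrite -vE; apply: coord_lipschitz => t t01.
  apply: gM; first exact: slide_D.
  by apply: le_trans (slide _ _ xa t01) _; rewrite ler_wpM2r.
have ab' : `|realify b' - realify a'| = d.
  by rewrite !realify_shift opprD addrACA subrr addr0.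
have a'E : a' = a + (1 * v)%:C *: rdir c by rewrite mul1r.
have a'a : `|realify a' - realify a| <= l * d.
  by rewrite -vE; exact: dist_shift.
have box z : `|realify z - realify a'| <= d -> D z.
  move=> za'.
  have close' w : `|realify w - realify a'| <= d -> `|realify w - realify p| < e.
    move=> wa'; apply: close; apply: le_trans (ler_distD (realify a') _ _) _.
    by clear -n wa' a'a; lra.
  have [Uz _ _] := eP _ (close' _ za'); apply/UD => //.
  have rza : `|r z - r a'| <= m%:R * L * `|realify z - realify a'|.
    apply: box_lipschitz => w wz c'.
    have [Uw Lw _] := eP _ (close' _ (le_trans wz za')).
    by split; [exact: (rS [::] _ Uw).2 c'|exact: Lw].
  have mLd : m%:R * L * `|realify z - realify a'| <= k * (l * d).
    have -> : k * (l * d) = m%:R * L * d by rewrite /l; field; rewrite gt_eqF.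
    by rewrite ler_wpM2l// mulr_ge0.
  have := slide_r a 1 aa; rewrite -a'E mul1r ler01 lexx => /(_ isT) ra'.
  have [Ua _ _] := eP _ (close _ (le_trans aa (le_trans dE (lexx _)))).
  have := (UD a Ua).1 Da.
  have := ler_norm (r z - r a'); clear -n rza mLd ra'; lra.
(* The path from a to b goes through a' and b'. *)
have gbox : `|g b' - g a'| <= m%:R * M * d.
  rewrite -ab'; apply: box_lipschitz => z; rewrite ab' => za'.
  apply: gM; first exact: box.
  apply: le_trans (ler_distD (realify a') _ _) _.
  apply: (@le_trans _ _ ((1 + l) * d)); first by clear -n za' a'a; lra.
  by rewrite ler_wpM2r.
have := gslide a Da aa; have := gslide b Db (lexx _).
rewrite -/a' -/b' => H1 H2.
have -> : g b - g a = (g a' - g a) + (g b' - g a') - (g b' - g b) by ring.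
apply: le_trans (ler_normB _ _) _; apply: le_trans (lerD (ler_normD _ _) (lexx _)) _.
have : (2 * l + m%:R) * M * d <= K * M * d.
  by rewrite ler_wpM2r// ler_wpM2r//; clear -n mK; lra.
have -> : (2 * l + m%:R) * M * d = M * (l * d) + m%:R * M * d + M * (l * d) by ring.
by clear -n H1 H2 gbox; lra.
Qed.

(** The local constants can be taken to be uniform because the closure is
compact and the property, once true for some K0, stays true for larger K. *)
Lemma quasi_convex D : open D -> bounded_set D -> smooth_boundary D ->
  exists2 K : R, 1 <= K & forall a, D a -> quasi_convex_at D K a.
Proof.
move=> oD bD sD.
pose P (K : R) a := D a -> quasi_convex_at D K a.
have cov := (compact_near_coveringP _).1 (compact_closure bD).
have [p clp|K0 [_ KP]] := cov R +oo P _.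
  have [K0 [e e0 H]] : exists K0 : R, exists2 e : R, 0 < e &
      forall a, `|realify a - realify p| < e -> D a ->
        forall K, K0 <= K -> quasi_convex_at D K a.
    have [Dp|nDp] := pselect (D p).
      have [K0 [e e0 H]] := quasi_convex_interior oD Dp.
      by exists K0, e => // a ap _; exact: H.
    exact: quasi_convex_boundary.
  exists ([set a | `|realify a - realify p| < e], [set K | K0 <= K]).
    split => /=; first by apply/nbhs_realify; exists e.
    by exists K0; split => [|K /ltW]; first exact: num_real.
  by move=> [a K] /= [ap KK0] Da; exact: H.
exists (Num.max 1 (K0 + 1)); first by rewrite le_max lexx.
move=> a Da; apply: KP => //; last exact: subset_closure.
by rewrite lt_max ltrDl ltr01 orbT.
Qed.

End QuasiConvexity.

(** * First-order expansions with uniform remainder *)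

Section Expansion.
Context {R : realType} {n : nat}.
Local Notation Cn := 'rV[R[i]]_n.
Local Notation coords := ('I_n * bool)%type.
Local Notation m := #|{: coords}|.
Local Notation E := 'rV[R]_m.
Variables (D : set Cn) (K M : R).
Hypothesis K1 : 1 <= K.
Hypothesis M0 : 0 <= M.
Hypothesis D_quasi_convex : forall a, D a -> quasi_convex_at D K a.

(** For points within this radius of a, all those involved in the estimate
of the gradient remain within K^-1 of a, the range of quasi-convexity. *)
Definition expansion_radius : R := (4 * K * (1 + 2 * K))^-1.
Definition expansion_const : R := K * (K * M * (1 + 2 * K)) + M + 1.

Let K0 : 0 < K. Proof. exact: lt_le_trans K1. Qed.

Let K2_gt0 : 0 < 1 + 2 * K.
Proof. by apply: addr_gt0 => //; exact: mulr_gt0. Qed.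

Lemma expansion_radius_gt0 : 0 < expansion_radius.
Proof. by rewrite invr_gt0; do 2!apply: mulr_gt0 => //. Qed.

Lemma expansion_const_ge1 : 1 <= expansion_const.
Proof.
rewrite /expansion_const lerDr; apply: addr_ge0 => //.
by do 3?apply: mulr_ge0 => //; exact: ltW.
Qed.

(** Quasi-convexity is used twice: for the partial derivatives of [g], whose
variation near [a] is then O(r), and for [g] minus its linear part at [a], whose
partial derivatives are therefore O(r). *)
Lemma taylor_remainder (g : Cn -> R) (a x y : Cn) (r : R) : smooth D g ->
  (forall z, D z -> forall c c', `|pderiv c' (pderiv c g) z| <= M) ->
  D a -> D x -> D y -> r <= expansion_radius ->
  `|realify x - realify a| <= r -> `|realify y - realify a| <= r ->
  `|g x - g y - (linear_form (fun c => pderiv c g a) x -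
                 linear_form (fun c => pderiv c g a) y)| <=
  expansion_const * r * `|realify x - realify y|.
Proof.
have K1_ := K1; have K0_ := K0; have M0_ := M0.
move=> sg M2 Da Dx Dy rr xa ya.
set l := linear_form _; set d := `|realify x - realify y|.
have r0 : 0 <= r by exact: le_trans xa.
have d0 : 0 <= d by exact: normr_ge0.
have d2r : d <= 2 * r.
  apply: le_trans (ler_distD (realify a) _ _) _.
  by rewrite [`|realify a - _|]distrC; lra.
have rK : (1 + 2 * K) * r < K^-1.
  have : (1 + 2 * K) * r <= (1 + 2 * K) * expansion_radius.
    by rewrite ler_wpM2l// ltW.
  move=> /le_lt_trans; apply.
  have -> : (1 + 2 * K) * expansion_radius = 4^-1 * K^-1.
    by rewrite /expansion_radius; field; rewrite !gt_eqF.
  by rewrite gtr_pMl ?invr_gt0//; lra.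
have K2 : 2 * r <= (1 + 2 * K) * r by rewrite ler_wpM2r//; lra.
have dK : `|realify x - realify y| < K^-1 by rewrite -/d; lra.
pose M' := K * M * (1 + 2 * K) * r.
have M'0 : 0 <= M' by do 3?apply: mulr_ge0 => //; exact: ltW.
have := D_quasi_convex Dy Dx dK (g := fun w => g w - l w) M'0.
rewrite opprD opprK addrACA -[- l x + l y]opprK opprD opprK -/d => H.
apply: le_trans (H _) _.
  move=> z Dz zy c.
  have [d1 d2] := pderiv_sub_linear (fun c => pderiv c g a) ((sg [::] z Dz).2 c).
  split; first exact: d1.
  rewrite d2.
  have za : `|realify z - realify a| <= (1 + 2 * K) * r.
    apply: le_trans (ler_distD (realify y) _ _) _.
    have : K * d <= K * (2 * r) by rewrite ler_wpM2l// ltW.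
    by move: zy; rewrite -/d; lra.
  have zK : `|realify z - realify a| < K^-1 by exact: le_lt_trans rK.
  have := D_quasi_convex Da Dz zK (g := pderiv c g) M0 => /(_ _)/le_trans; apply.
    by move=> w Dw _ c'; split; [exact: (sg [:: c] w Dw).2 c'|exact: M2].
  have -> : M' = K * M * ((1 + 2 * K) * r) by rewrite /M' !mulrA.
  by rewrite ler_wpM2l// mulr_ge0// ltW.
rewrite ler_wpM2r// /M' /expansion_const.
have -> : K * (K * M * (1 + 2 * K) * r) = K * (K * M * (1 + 2 * K)) * r by ring.
rewrite ler_wpM2r//; lra.
Qed.

Lemma map_expansion (h : Cn -> Cn) (a : Cn) : smooth_map D h ->
  (forall z, D z -> forall c0 c, `|pderiv c (real_coord c0 \o h) z| <= M) ->
  (forall z, D z -> forall c0 c c',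
     `|pderiv c' (pderiv c (real_coord c0 \o h)) z| <= M) ->
  D a ->
  exists J, expansion (complexify @^-1` D) expansion_const expansion_radius
    (realify \o h \o complexify) (realify a) J.
Proof.
move=> sh M1 M2 Da.
pose J : 'M[R]_m :=
  \matrix_(i, j) pderiv (enum_val i) (real_coord (enum_val j) \o h) a.
exists J; split=> [i j|r u v Du Dv rr ua va].
  rewrite mxE; apply: le_trans (M1 _ Da _ _) _.
  rewrite /expansion_const; have : 0 <= K * (K * M * (1 + 2 * K)).
    by do 3?apply: mulr_ge0 => //; exact: ltW.
  lra.
have r0 : 0 <= r by exact: le_trans ua.
rewrite -[u]complexifyK -[v]complexifyK /= !realifyK.
rewrite -{1}[u]complexifyK in ua; rewrite -{1}[v]complexifyK in va.
apply: norm_row_le => [|j].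
  by rewrite !mulr_ge0// (le_trans _ expansion_const_ge1).
set x := complexify u in Du ua *; set y := complexify v in Dv va *.
have := taylor_remainder (sh (enum_val j)) (fun z Dz => M2 z Dz _) Da Du Dv rr ua va.
congr (_ <= _); congr (`| _ |).
have jE w : realify w 0 j = real_coord (enum_val j) w by rewrite mxE.
rewrite !row_subE !jE; congr (_ - _).
rewrite /linear_form -sumrB mxE (reindex (@enum_val coords predT)) /=; last first.
  exact/onW_bij/enum_val_bij.
apply: eq_bigr => k _; rewrite row_subE !mxE; ring.
Qed.

End Expansion.

(** * Self-maps of a domain in the compact-open topology *)

Section SelfMaps.
Context {R : realType} {n : nat}.
Local Notation Cn := 'rV[R[i]]_n.
Local Notation coords := ('I_n * bool)%type.
Variable D : set Cn.
Hypothesis oD : open D.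
Implicit Types (z w : D) (f g h : D -> D).

Lemma ext0E f z : ext0 f (val z) = val (f z).
Proof.
have := congr1 (fun F => F z) (valLK (0 : Cn) (set_val \o f)).
by rewrite /sigL /=.
Qed.

Lemma val_in z : D (val z).
Proof. exact: set_mem (valP z). Qed.

Lemma val_surj (p : Cn) : D p -> exists z : D, val z = p.
Proof. by move=> Dp; exists (exist _ p (mem_set Dp)). Qed.

Lemma nbhs_subtype z (A : set D) : nbhs z A <->
  exists2 e : R, 0 < e &
    forall w, `|realify (val w) - realify (val z)| < e -> A w.
Proof.
split=> [[_ [[B oB <-] Bz BA]]|[e e0 eA]].
  have [e e0 eB] := open_realify oB Bz.
  by exists e => // w wz; apply: BA; exact: eB.
have : nbhs (val z) [set p | `|realify p - realify (val z)| < e].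
  by apply/nbhs_realify; exists e.
move=> /(@initial_continuous D Cn set_val z).
by apply: (@filterS _ (nbhs z) (nbhs_filter z)) => w /=; exact: eA.
Qed.

Lemma compact_subtype (C : set Cn) : compact C -> C `<=` D ->
  compact (set_val @^-1` C : set D).
Proof.
move=> cC CD F FF FC.
have [p [Cp clp]] : C `&` cluster (set_val @ F) !=set0 by exact: cC.
have [z zp] := val_surj (CD _ Cp).
exists z; split; first by rewrite /= -[set_val z]/(val z) zp.
move=> A B FA /nbhs_subtype[e e0 eB].
have FA' : F (set_val @^-1` (set_val @` A)).
  by apply: filterS FA => w Aw; exists w.
have [_ [[w Aw <-] wp]] : set_val @` A `&`
    [set q | `|realify q - realify p| < e] !=set0.
  apply: (clp _ _ FA').
  by apply/nbhs_realify; exists e.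
by exists w; split => //; apply: eB; rewrite zp.
Qed.

(** An exhaustion of [D] by compact sets as r tends to 0. *)
Definition inner_core (r : R) : set Cn :=
  [set p | forall q, `|realify q - realify p| < r -> D q].

Lemma inner_core_sub r : 0 < r -> inner_core r `<=` D.
Proof. by move=> r0 p; apply; rewrite subrr normr0. Qed.

Lemma compact_inner_core r : bounded_set D -> 0 < r -> compact (inner_core r).
Proof.
move=> bD r0; apply: subclosed_compact (compact_closure bD) _; last first.
  by apply: subset_trans (inner_core_sub r0) _; exact: subset_closure.
move=> p clp q qp; pose e := r - `|realify q - realify p|.
have e0 : 0 < e by rewrite subr_gt0.
have [w wc wp] := closure_realify clp e0.
apply: wc; apply: le_lt_trans (ler_distD (realify p) _ _) _.
by rewrite [`|realify p - _|]distrC; move: wp; rewrite /e; lra.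
Qed.

Lemma near_inner_core z : exists2 e : R, 0 < e & forall w r,
  `|realify (val w) - realify (val z)| < e -> r <= e -> inner_core r (val w).
Proof.
have [e e0 eD] := open_realify oD (val_in z).
exists (e / 2); first by rewrite divr_gt0.
move=> w r wz re q qw; apply: eD.
by apply: le_lt_trans (ler_distD (realify (val w)) _ _) _; lra.
Qed.

Definition real_continuous h := forall z (e : R), 0 < e -> exists2 d : R, 0 < d &
  forall w, `|realify (val w) - realify (val z)| < d ->
    `|realify (val (h w)) - realify (val (h z))| < e.

(** Uniform closeness on a compact set defines a neighbourhood of a continuous
map: around each point, requiring a small compact ball to be mapped into a small
open set is a subbasic condition, and finitely many such conditions suffice. *)
Lemma compact_open_nbhs h (r e : R) : bounded_set D -> real_continuous h ->
  0 < r -> 0 < e ->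
  nbhs (h : {compact-open, D -> D}) [set g : {compact-open, D -> D} |
    forall z, inner_core r (val z) ->
      `|realify (val ((g : D -> D) z)) - realify (val (h z))| < e].
Proof.
move=> bD ch r0 e0.
have cov := (compact_near_coveringP _).1
  (compact_subtype (compact_inner_core bD r0) (inner_core_sub r0)).
pose P (g : {compact-open, D -> D}) z :=
  `|realify (val ((g : D -> D) z)) - realify (val (h z))| < e.
have := cov _ (nbhs (h : {compact-open, D -> D})) P (nbhs_filter _).
move=> H; have {H} : \forall g \near (h : {compact-open, D -> D}),
    (set_val @^-1` inner_core r : set D) `<=` P g.
  apply: H => z _.
  have [d d0 dh] := ch z (e / 2) (divr_gt0 e0 (ltr0n _ 2)).
  have [d' d'0 d'D] := open_realify oD (val_in z).
  pose s := Num.min (d / 2) (d' / 2).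
  have s0 : 0 < s by rewrite lt_min !divr_gt0.
  have [sd sd'] : s < d /\ s < d'.
    by split; rewrite gt_min; apply/orP; [left|right]; lra.
  pose C := [set p : Cn | `|realify p - realify (val z)| <= s].
  have CD : C `<=` D by move=> p Cp; apply: d'D; exact: le_lt_trans sd'.
  have cC := compact_subtype (@compact_realify_ball R n (val z) s) CD.
  pose O := [set w : D | `|realify (val w) - realify (val (h z))| < e / 2].
  have oO : open O.
    rewrite openE => w Ow; apply/nbhs_subtype.
    exists (e / 2 - `|realify (val w) - realify (val (h z))|).
      by rewrite subr_gt0.
    move=> w' w'w; rewrite /O /=.
    by apply: le_lt_trans (ler_distD (realify (val w)) _ _) _; lra.
  exists ((set_val @^-1` C : set D), [set g : {compact-open, D -> D} |
      (g : D -> D) @` (set_val @^-1` C) `<=` O]).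
    split => /=.
      by apply/nbhs_subtype; exists s => // w ws; exact: ltW.
    apply: open_nbhs_nbhs; split; first exact: compact_open_open.
    by move=> _ [w Cw <-]; apply: dh; apply: le_lt_trans Cw sd.
  move=> [w g] /= [Cw gO].
  have gw : O (g w) by apply: gO; exists w.
  have hw : O (h w) by apply: dh; apply: le_lt_trans Cw sd.
  rewrite /P; apply: le_lt_trans (ler_distD (realify (val (h z))) _ _) _.
  by rewrite [`|realify (val (h z)) - _|]distrC; move: gw hw; rewrite /O /=; lra.
exact.
Qed.

(** The inner cores exhaust [D], so closeness to within 1/j on the j-th one
is enough for convergence in the compact-open topology.  With the previous
lemma, this lets a cluster point of a sequence be reached along a
subsequence. *)
Lemma compact_open_cvg_inner_core (u : nat -> D -> D) h : real_continuous h ->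
  (forall j z, inner_core j.+1%:R^-1 (val z) ->
    `|realify (val (u j z)) - realify (val (h z))| < j.+1%:R^-1) ->
  (u : nat -> {compact-open, D -> D}) @ \oo --> (h : {compact-open, D -> D}).
Proof.
move=> ch uh; apply/compact_open_cvgP => C O cC oO hCO.
have cov := (compact_near_coveringP _).1 cC.
have H : \forall j \near \oo, C `<=` (fun z => O (u j z)).
  apply: (cov nat \oo (fun j z => O (u j z))) => z Cz.
  have /(open_nbhs_nbhs) /nbhs_subtype[e e0 eO] : open_nbhs (h z) O.
    by split => //; apply: hCO; exists z.
  have [d d0 dh] := ch z (e / 2) (divr_gt0 e0 (ltr0n _ 2)).
  have [d' d'0 zcore] := near_inner_core z.
  exists ([set w : D | `|realify (val w) - realify (val z)| < Num.min d d'],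
    [set j : nat | j.+1%:R^-1 < Num.min d' (e / 2)]).
    split => /=.
      by apply/nbhs_subtype; exists (Num.min d d'); rewrite ?lt_min ?d0.
    near=> j.
    have m0 : 0 < Num.min d' (e / 2) by rewrite lt_min d'0 divr_gt0.
    rewrite /= invf_plt ?posrE//.
    have : (Num.min d' (e / 2))^-1 < j%:R by near: j; exact: nbhs_infty_gtr.
    by move=> /lt_trans; apply; rewrite ltr_nat.
  move=> [w j] /= []; rewrite !lt_min => /andP[wd wd'] /andP[jd' je].
  apply: eO; apply: le_lt_trans (ler_distD (realify (val (h w))) _ _) _.
  have := lt_trans (uh j w (zcore _ _ wd' (ltW jd'))) je; have := dh w wd; lra.
by apply: filterS H => j H _ [z Cz <-]; exact: H.
Unshelve. all: by end_near. Qed.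

End SelfMaps.

(** * Uniform bounds on derivatives over a compact family *)

Section UniformBounds.
Context {R : realType} {n : nat}.
Local Notation Cn := 'rV[R[i]]_n.
Local Notation coords := ('I_n * bool)%type.
Variable D : set Cn.
Hypothesis oD : open D.
Hypothesis bD : bounded_set D.
Implicit Types (f g h : D -> D) (s : seq coords) (c : coords).

Definition extends_smoothly f :=
  exists2 F, closure_diffeo D F & forall z : D, F (val z) = val (f z).

Definition pderivs_comp s c f : Cn -> R := pderivs s (real_coord c \o ext0 f).

(** What smoothness up to the boundary means for [f], which is only defined on
the open set [D]. *)
Lemma local_extension f : extends_smoothly f -> forall p, closure D p ->
  exists2 U, open_nbhs p U & exists2 G, smooth_map U G &
    forall z, U z -> D z -> \forall w \near z, forall c,
      (real_coord c \o ext0 f) w = (real_coord c \o G) w.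
Proof.
move=> [F [F' [_ _ _ _ [sF _]]] Ff] p clp.
have [U [G [Up sG FG]]] := sF p clp.
exists U => //; exists G => // z Uz Dz.
have UDz : nbhs z (U `&` D).
  by apply: open_nbhs_nbhs; split => //; apply: openI => //; case: Up.
apply: (@filterS _ (nbhs z) (nbhs_filter z)) UDz => w [Uw Dw] c /=.
have [v vw] := val_surj Dw; rewrite -vw ext0E -Ff FG// vw.
by apply/mem_set; split; [exact: Uw|exact: subset_closure].
Qed.

Lemma smooth_ext0 f : extends_smoothly f -> smooth_map D (ext0 f).
Proof.
move=> ef c s z Dz.
have [U [oU Uz] [G sG fG]] := local_extension ef (subset_closure Dz).
have near_eq s' : \forall w \near z,
    pderivs s' (real_coord c \o G) w = pderivs s' (real_coord c \o ext0 f) w.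
  apply: pderivs_near; apply: (@filterS _ (nbhs z) (nbhs_filter z)) (fG z Uz Dz).
  by move=> w /(_ c) ->.
have [sc sd] := sG c s z Uz.
split; last by move=> c'; exact: (pderiv_near c' (near_eq s)).2 (sd c').
have Eq := near_eq s.
have [d d0 dE] := (nbhs_realify _ _).1 Eq.
apply/continuous_realify => e e0.
have [d' d'0 dc] := (continuous_realify _ _).1 sc e e0.
exists (Num.min d d'); first by rewrite lt_min d0.
move=> w; rewrite lt_min => /andP[wd wd'].
rewrite -dE// -dE ?subrr ?normr0//.
exact: dc.
Qed.

Lemma pderivs_comp_bounded f s c : extends_smoothly f ->
  exists M : R, forall z, D z -> `|pderivs_comp s c f z| <= M.
Proof.
move=> ef.
have cov := (compact_near_coveringP _).1 (compact_closure bD).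
have [p clp|M0 [_ MP]] := cov R +oo
   (fun M z => D z -> `|pderivs_comp s c f z| <= M) _; last first.
  exists (M0 + 1) => z Dz; apply: MP => //; last exact: subset_closure.
  by rewrite ltrDl.
have [U [oU Up] [G sG fG]] := local_extension ef clp.
have [sc _] := sG c s p Up.
have [d d0 dc] := (continuous_realify _ _).1 sc 1 ltr01.
have [d' d'0 dU] := open_realify oU Up.
exists ([set z | `|realify z - realify p| < Num.min d d'],
  [set M | `|pderivs s (real_coord c \o G) p| + 1 <= M]).
  split => /=.
    by apply/nbhs_realify; exists (Num.min d d'); rewrite ?lt_min ?d0.
  exists (`|pderivs s (real_coord c \o G) p| + 1).
  by split => [|M /ltW]; first exact: num_real.
move=> [z M] /= []; rewrite lt_min => /andP[zd zd'] HM Dz.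
have -> : pderivs_comp s c f z = pderivs s (real_coord c \o G) z.
  have fGc : \forall w \near z, (real_coord c \o ext0 f) w = (real_coord c \o G) w.
    apply: (@filterS _ (nbhs z) (nbhs_filter z)) (fG z (dU _ zd') Dz).
    by move=> w /(_ c).
  exact: (nbhs_singleton (pderivs_near s fGc)).
have := dc z zd.
have := ler_distD (pderivs s (real_coord c \o G) p)
  (pderivs s (real_coord c \o G) z) 0.
rewrite !subr0; lra.
Qed.

Lemma closure_ext_in (g : Cn -> R) z : D z -> {for z, continuous g} ->
  closure_ext D g z = g z.
Proof.
move=> Dz gz; rewrite /closure_ext.
have -> : within D (nbhs z) = nbhs z.
  by by apply: within_interior; move: oD; rewrite openE; exact.
exact: cvg_lim gz.
Qed.

Lemma smooth_real_continuous f : extends_smoothly f -> real_continuous f.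
Proof.
move=> ef z e e0.
have cf c := (smooth_ext0 ef c [::] (val_in z)).1.
have H : \forall w \near (val z), forall c,
    `|real_coord c (ext0 f w) - real_coord c (ext0 f (val z))| < e.
  apply: (@filter_forall _ _ (fun c => [set w |
    `|real_coord c (ext0 f w) - real_coord c (ext0 f (val z))| < e])
     (nbhs (val z)) (nbhs_filter _)) => c.
  by apply/nbhs_realify; exact: (continuous_realify _ _).1 (cf c) e e0.
have [d d0 dH] := (nbhs_realify _ _).1 H.
exists d => // w wz; have := dH _ wz; rewrite !ext0E => fwz.
by apply: norm_row_lt => // k; rewrite -realifyB mxE real_coordB.
Qed.

(** Otherwise some sequence in [H] has derivatives of sup norm going to
infinity.  By compactness it has a cluster point h in [H], and a subsequence
converging to h uniformly on the inner cores, that is in the compact-open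
topology; by hypothesis its derivatives converge uniformly to those of h,
which are bounded. *)
Lemma uniform_pderivs_bound (H : set (D -> D)) s c :
  (forall f, H f -> extends_smoothly f) ->
  compact (H : set {compact-open, D -> D}) ->
  (forall (u : nat -> D -> D) h, (forall k, H (u k)) -> H h ->
     (u : nat -> {compact-open, D -> D}) @ \oo --> (h : {compact-open, D -> D}) ->
     smooth_cvg u h) ->
  exists M : R, forall f, H f -> forall z, D z -> `|pderivs_comp s c f z| <= M.
Proof.
move=> Hext cH Hcvg; apply: contrapT => nM.
have /choice[f fP] : forall k : nat, exists f, H f /\
    exists2 z, D z & k%:R < `|pderivs_comp s c f z|.
  move=> k; apply: contrapT => nf; apply: nM; exists k%:R => f Hf z Dz.
  by rewrite leNgt; apply/negP => kz; apply: nf; exists f; split => //; exists z.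
have [h [Hh clh]] : (H : set {compact-open, D -> D}) `&`
    cluster ((f : nat -> {compact-open, D -> D}) @ \oo) !=set0.
  apply: cH; suff : \forall k \near \oo, H (f k) by [].
  by apply: nearW => k; have [] := fP k.
have ch := smooth_real_continuous (Hext h Hh).
have /choice[k kP] : forall j : nat, exists k : nat, (j <= k)%N /\
    forall z : D, inner_core D j.+1%:R^-1 (val z) ->
      `|realify (val (f k z)) - realify (val (h z))| < j.+1%:R^-1.
  move=> j; have j0 : 0 < j.+1%:R^-1 :> R by [].
  have fj : ((f : nat -> {compact-open, D -> D}) @ \oo) (f @` [set k | (j <= k)%N]).
    suff : \forall k \near \oo, (f @` [set k | (j <= k)%N]) (f k) by [].
    by exists j => // k jk; exists k.
  have [_ [[k jk <-] kh]] := clh _ _ fj (compact_open_nbhs oD bD ch j0 j0).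
  by exists k; split.
pose u j := f (k j).
have Hu j : H (u j) by have [] := fP (k j).
have := Hcvg u h Hu Hh (compact_open_cvg_inner_core oD ch (fun j => (kP j).2)) c s.
have [M hM] := pderivs_comp_bounded s c (Hext h Hh).
set lim_h := closure_ext D _.
have N1 : nbhs (lim_h : {uniform` closure D -> R})
    [set g : {uniform` closure D -> R} | forall z, closure D z -> `|lim_h z - g z| < 1].
  apply/uniform_nbhs; exists [set xy : R * R | ball xy.1 1 xy.2]; split.
    exact: (@entourage_ball _ R 1%:pos).
  by [].
move=> /(_ _ N1)[N _ NP].
have [j Nj jM] : exists2 j, (N <= j)%N & M + 1 < j%:R.
  have [N' _ N'P] := nbhs_infty_gtr (M + 1).
  by exists (maxn N N'); [exact: leq_maxl|apply: N'P; exact: leq_maxr].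
have [_ [z Dz zbig]] := fP (k j).
have := NP j Nj z (subset_closure Dz).
have inD g : H g -> closure_ext D (pderivs_comp s c g) z = pderivs_comp s c g z.
  move=> Hg; apply: closure_ext_in => //.
  exact: (smooth_ext0 (Hext g Hg) c s Dz).1.
rewrite /lim_h !inD// => close.
have := ler_distD (pderivs_comp s c h z) (pderivs_comp s c (u j) z) 0.
have := hM z Dz; rewrite !subr0.
have : j%:R <= (k j)%:R :> R by rewrite ler_nat; have [] := kP j.
rewrite distrC in close; move: zbig close jM; rewrite -/(u j).
lra.
Qed.

End UniformBounds.

(** * Separation and counting of fixed points *)

(** Two points in the same cell of a grid of mesh d are at distance at most d, so
S injects into the set of cells, which depends only on [k], [M] and [d]. *)
Lemma separated_card (R : realType) (k : nat) (M d : R) : 0 < d ->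
  exists m : nat, forall (T : choiceType) (S : set T) (phi : T -> 'rV[R]_k),
    (forall x, S x -> `|phi x| <= M) ->
    (forall x y, S x -> S y -> `|phi x - phi y| <= d -> x = y) ->
    (S #<= `I_m)%card.
Proof.
move=> d0; pose N := Num.truncn ((M + M) / d).
exists #|{ffun 'I_k -> 'I_N.+1}| => T S phi SM Ssep.
pose slot x i := Num.truncn ((phi x 0 i + M) / d).
have entryM x i : S x -> - M <= phi x 0 i <= M.
  by move=> Sx; rewrite -ler_norml; exact: le_trans (norm_entry _ _ _) (SM x Sx).
have slot_lt x i : S x -> (slot x i < N.+1)%N.
  move=> Sx; rewrite ltnS; apply: le_truncn.
  rewrite ler_pM2r ?invr_gt0// lerD2r; by have /andP[] := entryM x i Sx.
pose cell x : {ffun 'I_k -> 'I_N.+1} := [ffun i => inord (slot x i)].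
pose rank x : nat := enum_rank (cell x).
have rank_inj : {in S &, injective rank}.
  move=> x y /set_mem Sx /set_mem Sy /ord_inj /enum_rank_inj xy.
  apply: Ssep => //; apply: norm_row_le => [|i]; first exact: ltW.
  have : slot x i = slot y i.
    move: xy => /ffunP/(_ i); rewrite !ffunE => /(congr1 val) /=.
    by rewrite !inordK ?slot_lt.
  have pos z : S z -> 0 <= (phi z 0 i + M) / d.
    move=> Sz; apply: divr_ge0; last exact: ltW.
    by have /andP[? _] := entryM z i Sz; lra.
  have /andP[x1 x2] := truncn_itv (pos x Sx).
  have /andP[y1 y2] := truncn_itv (pos y Sy).
  rewrite -/(slot x i) in x1 x2; rewrite -/(slot y i) in y1 y2 => E.
  move: y1 y2; rewrite -E => y1 y2.
  move: x1 x2 y1 y2; rewrite -natr1.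
  rewrite !ler_pdivlMr// !ltr_pdivrMr// => x1 x2 y1 y2.
  by rewrite row_subE ler_norml; lra.
rewrite -(card_le_eql (inj_card_eq rank_inj)).
by apply: subset_card_le => _ [x _ <-] /=; exact: ltn_ord.
Qed.

Section Assembly.
Context {R : realType} {n : nat}.
Local Notation Cn := 'rV[R[i]]_n.
Local Notation coords := ('I_n * bool)%type.
Variable D : set Cn.
Hypothesis oD : open D.
Hypothesis bD : bounded_set D.
Hypothesis sD : smooth_boundary D.

(** In real coordinates the elements of [H] form a group of maps with uniform
expansions, to which [nearby_fixed_points_not_isolated] applies. *)
Lemma fixed_points_separated (H : set (D -> D)) :
  subgroup_holoAut H ->
  (forall f, H f -> extends_smoothly f) ->
  (forall s c, exists M : R, forall f, H f -> forall z, D z -> `|pderivs_comp s c f z| <= M) ->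
  exists2 d : R, 0 < d & forall f, H f -> Fix f `<=` isolated (Fix f) ->
    forall x y : D, Fix f x -> Fix f y ->
      `|realify (val x) - realify (val y)| <= d -> x = y.
Proof.
move=> [_ Hid Hcomp Hinv] Hext Hbound.
have [K K1 DK] := quasi_convex oD bD sD.
have /choice[M1 M1P] : forall q : coords * coords, exists M : R,
    forall f, H f -> forall z, D z -> `|pderivs_comp [:: q.2] q.1 f z| <= M.
  by move=> q; exact: Hbound.
have /choice[M2 M2P] : forall q : coords * coords * coords, exists M : R,
    forall f, H f -> forall z, D z -> `|pderivs_comp [:: q.2; q.1.2] q.1.1 f z| <= M.
  by move=> q; exact: Hbound.
pose M := \sum_q `|M1 q| + \sum_q `|M2 q|.
have M0 : 0 <= M by rewrite addr_ge0 ?sumr_ge0.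
have M1M q : M1 q <= M.
  apply: le_trans (ler_norm _) _; rewrite /M (bigD1 q) //= -addrA lerDl.
  by rewrite addr_ge0 ?sumr_ge0.
have M2M q : M2 q <= M.
  apply: le_trans (ler_norm _) _; rewrite /M [X in _ <= _ + X](bigD1 q) //=.
  by rewrite addrCA lerDl addr_ge0 ?sumr_ge0.
pose X := complexify @^-1` D.
pose chart (f : D -> D) := realify \o ext0 f \o complexify.
pose HE : set ('rV[R]_#|{: coords}| -> 'rV[R]_#|{: coords}|) :=
  [set F | exists2 f, H f & forall u, X u -> F u = chart f u].
have chartE f (x : D) : chart f (realify (val x)) = realify (val (f x)).
  by rewrite /chart /= realifyK ext0E.
have XE u : X u -> exists x : D, u = realify (val x).
  by move=> /val_surj[x xu]; exists x; rewrite xu complexifyK.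
have inX (x : D) : X (realify (val x)) by rewrite /X /= realifyK; exact: val_in.
have openX : open X.
  by apply: open_comp oD => u _; exact: complexify_continuous.
have stable F u : HE F -> X u -> X (F u).
  by move=> [f _ Ff] Xu; rewrite Ff//; have [x ->] := XE u Xu; rewrite chartE.
have [||||d d0 dP] := @nearby_fixed_points_not_isolated R #|{: coords}| X
  (expansion_const K M) (expansion_radius K) (expansion_const_ge1 K1 M0)
  (expansion_radius_gt0 K1) HE openX stable _ _ _ _.
- by exists id => // u /XE[x ->]; rewrite chartE.
- move=> F G [f Hf Ff] [g Hg Gg]; exists (f \o g); first exact: Hcomp.
  by move=> u /XE[x ->]; rewrite -[LHS]/(F (G _)) Gg// chartE Ff// !chartE.
- move=> F [f Hf Ff]; have [g Hg [fg gf]] := Hinv f Hf.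
  exists (chart g); first by exists g.
  move=> u /XE[x ->]; split; first by rewrite Ff// !chartE fg.
  by rewrite chartE Ff// chartE gf.
- move=> F a [f Hf Ff] /XE[x ->].
  have [J [JC JE]] := @map_expansion R n D K M K1 M0 DK (ext0 f) (val x)
    (smooth_ext0 oD (Hext f Hf))
    (fun z Dz c0 c => le_trans (M1P (c0, c) f Hf z Dz) (M1M _))
    (fun z Dz c0 c c' => le_trans (M2P (c0, c, c') f Hf z Dz) (M2M _)) (val_in x).
  exists J; split => // r u v Xu Xv; rewrite !Ff//; exact: JE.
- exists d => // f Hf iso x y fx fy xy; apply: contrapT => nxy.
  have [_ [V /nbhs_subtype[e e0 eV] VF]] := iso x fx.
  have [|||||z [Xz zx ze fz]] := dP (chart f) (realify (val x)) (realify (val y))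
    _ (inX x) (inX y) _ _ _ _ e e0.
  + by exists f.
  + by rewrite chartE fx.
  + by rewrite chartE fy.
  + apply/eqP => /(can_inj realifyK)/val_inj yx; exact: nxy.
  + by rewrite distrC.
  have [w zw] := XE z Xz.
  have fw : f w = w.
    by apply/val_inj/(can_inj realifyK); rewrite -chartE -zw fz zw.
  have /= wx : w = x.
    have : (V `&` Fix f) w by split => //; apply: eV; rewrite -zw.
    by rewrite VF.
  by move: zx; rewrite zw wx eqxx.
Qed.

End Assembly.


Unset Implicit Arguments.
Set Strict Implicit.

Theorem theorem1p6 (R : realType) (n : nat) (D : set 'rV[R[i]]_n)
  (D_domain : domain D) (D_bounded : bounded_set D)
  (D_smooth : smooth_boundary D)
  (Aut_extends : forall f : D -> D, holoAut D f ->
     exists2 F, closure_diffeo D F & forall z : D, F (val z) = val (f z))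
  (Aut_cvg : forall (f_ : nat -> D -> D) (f : D -> D),
     (forall k, holoAut D (f_ k)) -> holoAut D f ->
     (f_ : nat -> {compact-open, D -> D}) @ \oo -->
       (f : {compact-open, D -> D}) ->
     smooth_cvg f_ f)
  (H : set (D -> D)) (H_subgroup : subgroup_holoAut H)
  (H_compact : compact (H : set {compact-open, D -> D})) :
  exists m : nat, forall f : D -> D, H f ->
    Fix f `<=` isolated (Fix f) ->
    finite_set (Fix f) /\ (Fix f #<= `I_m)%card.
Proof.
have [_ oD _] := D_domain.
have [HA _ _ _] := H_subgroup.
have Hext f : H f -> extends_smoothly f by move=> /HA /Aut_extends.
have Hcvg (u : nat -> D -> D) h : (forall k, H (u k)) -> H h ->
    (u : nat -> {compact-open, D -> D}) @ \oo --> (h : {compact-open, D -> D}) ->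
    smooth_cvg u h.
  by move=> Hu Hh; apply: Aut_cvg => [k|]; exact: HA.
have [d d0 sep] := fixed_points_separated oD D_bounded D_smooth H_subgroup Hext
  (fun s c => uniform_pderivs_bound oD D_bounded s c Hext H_compact Hcvg).
have [M M0 DM] := bounded_realify D_bounded.
have [m mP] := separated_card #|{: 'I_n * bool}| M d0.
exists m => f Hf iso.
have Fm : (Fix f #<= `I_m)%card.
  apply: (mP _ _ (fun z : D => realify (val z))) => [x _|].
    by apply: DM; exact: val_in.
  exact: sep Hf iso.
by split => //; apply/finite_set_leP; exists m.
Qed.
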